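(* Let $G$ be a discrete group and let $\varphi:G\times G\to\mathbb{C}$ be a compact Schur multiplier. Then the function $\psi:G\times G\to\mathbb{C}$, given by $\psi(s,t)=\varphi(t,s^{-1}t)$, is a completely compact Herz-Schur $(\mathcal{C},G,\alpha)$-multiplier; that is, the map $F:G\to\mathrm{CB}(\mathcal{C})$ given by $F(s)(M_a)=M_{h_sa}$, where $h_s(t)=\psi(s,t)$, $a\in c_0(G)$, $s,t\in G$, is a Herz-Schur $(\mathcal{C},G,\alpha)$-multiplier for which $S_F$ is completely compact.
   Context: For $a\in c_0(G)$, $M_a$ is the multiplication operator $(M_a\xi)(s)=a(s)\xi(s)$ on $\ell^2(G)$; $\mathcal{C}=\{M_a:a\in c_0(G)\}$; the action $\alpha$ of $G$ on $\mathcal{C}$ is $\alpha_t(M_a)=M_{\alpha_t(a)}$ with $\alpha_t(a)(s)=a(t^{-1}s)$. A function $\varphi:G\times G\to\mathbb{C}$ is a Schur multiplier if $S_\varphi:(x_{p,q})_{p,q}\mapsto(\varphi(q,p)x_{p,q})_{p,q}$ is a completely bounded map on $\mathcal{B}(\ell^2(G))$ (operators identified with their $G\times G$ matrices); it is compact if the map it induces on the C*-algebra $\mathcal{K}$ of compact operators on $\ell^2(G)$ is compact. For a C*-dynamical system $(A,G,\alpha)$ with $A\subseteq\mathcal{B}(H)$ non-degenerate, on $\mathcal{H}=\ell^2(G,H)$ put $(\lambda_t\xi)(s)=\xi(t^{-1}s)$ and $(\pi(a)\xi)(s)=\alpha_{s^{-1}}(a)(\xi(s))$. For $f\in\ell^1(G,A)$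 let $\tilde\pi(f)=\sum_{s\in G}\pi(f(s))\lambda_s$; the reduced crossed product $A\rtimes_{\alpha,r}G$ is the norm closure of $\tilde\pi(\ell^1(G,A))$. A bounded map $F:G\to\mathrm{CB}(A)$ is a Herz-Schur $(A,G,\alpha)$-multiplier if the map $S_F:\tilde\pi(f)\mapsto\tilde\pi(F\cdot f)$, where $(F\cdot f)(t)=F(t)(f(t))$, is completely bounded (and $S_F$ also denotes its extension to $A\rtimes_{\alpha,r}G$). A completely bounded map $\Psi:\mathcal{X}\to\mathcal{Z}$ between operator spaces is completely compact if for every $\epsilon>0$ there is a finite dimensional subspace $\mathcal{Y}\subseteq\mathcal{Z}$ such that $\mathrm{dist}(\Psi^{(m)}(x),M_m(\mathcal{Y}))<\epsilon$ for all $m\in\mathbb{N}$ and all $x\in M_m(\mathcal{X})$ with $\|x\|\le1$. *)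

(* Defs.v *)
From HB Require Import structures.
From mathcomp Require Import all_boot all_order all_algebra complex.
From mathcomp Require Import all_classical all_reals all_analysis.
From mathcomp Require Import ring.
From mathcomp Require showcase.summability.

Set Implicit Arguments.
Unset Strict Implicit.
Unset Printing Implicit Defensive.
Import Order.TTheory GRing.Theory Num.Theory.
Import numFieldNormedType.Exports.
Local Open Scope classical_set_scope.
Local Open Scope ring_scope.
Local Open Scope complex_scope.

Section real_norm.
Context {R : realType} {V : normedModType R[i]}.
Implicit Types x y : V.

(* In a normedModType over R[i] the norm `|x| takes its values in R[i];
   nrm x is the same number seen in R. *)
Definition nrm x : R := complex.Re `|x|.

Lemma nrmE x : `|x| = (nrm x)%:C.
Proof.
have := normr_ge0 x; rewrite /nrm; case: `|x| => a b.
by rewrite lecE /= => /andP[/eqP ->].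
Qed.

Lemma nrm_ge0 x : 0 <= nrm x.
Proof. by have := normr_ge0 x; rewrite nrmE lecR. Qed.

Lemma nrmD x y : nrm (x + y) <= nrm x + nrm y.
Proof. by have := ler_normD x y; rewrite !nrmE -rmorphD lecR. Qed.

Lemma nrmZ (a : R[i]) x : nrm (a *: x) = ComplexField.Normc.normc a * nrm x.
Proof.
apply: (@complexI R); rewrite [RHS]rmorphM -!nrmE normrZ.
by congr (_ * _); exact: nrmE.
Qed.

Lemma nrm0 : nrm (0 : V) = 0.
Proof. by rewrite /nrm normr0. Qed.

Lemma nrm0_eq0 x : nrm x = 0 -> x = 0.
Proof. by move=> x0; apply/normr0_eq0; rewrite nrmE x0. Qed.

End real_norm.

(* The Hilbert sum l^2(I, V) of copies of V indexed by I; it is l^2(I) when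
   V is the field R[i]^o, and the m-fold direct sum V^m when I is 'I_m. *)
Section ell2.
Context {R : realType} {I : choiceType} {V : normedModType R[i]}.

Definition sqsum (f : I -> V) : \bar R :=
  (\esum_(i in [set: I]) (nrm (f i) ^+ 2)%:E)%E.

Definition sqsummable : {pred I -> V} := fun f => (sqsum f < +oo)%E.

Record ell2 := Ell2 { ell2_fun :> I -> V; _ : ell2_fun \in sqsummable }.

HB.instance Definition _ := [isSub for ell2_fun].
HB.instance Definition _ := [Choice of ell2 by <:].

Lemma sqsum_ge0 f : (0 <= sqsum f)%E.
Proof. by apply: esum_ge0 => i _; rewrite lee_fin sqr_ge0. Qed.

Lemma sqsum_fin f : f \in sqsummable -> sqsum f = (fine (sqsum f))%:E.
Proof. by move=> fin; rewrite fineK// ge0_fin_numE ?sqsum_ge0. Qed.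

Lemma esumZ_le (c : R) (a : I -> R) : 0 <= c -> (forall i, 0 <= a i) ->
  (\esum_(i in [set: I]) (c * a i)%:E <= c%:E * \esum_(i in [set: I]) (a i)%:E)%E.
Proof.
move=> c0 a0; apply: ge_ereal_sup => _ [A [finA _] <-].
under eq_fsbigr do rewrite EFinM.
rewrite -ge0_mule_fsumr; last by move=> i; rewrite lee_fin.
by apply: lee_wpmul2l; [rewrite lee_fin|apply: ereal_sup_ubound; exists A].
Qed.

Lemma sqsumZ_le (a : R[i]) f :
  (sqsum (a *: f) <= (ComplexField.Normc.normc a ^+ 2)%:E * sqsum f)%E.
Proof.
apply: le_trans (esumZ_le _ _); [|exact: sqr_ge0|by move=> i; exact: sqr_ge0].
by apply: le_esum => i _; rewrite -exprMn -nrmZ.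
Qed.

Lemma sqsumD_le (t : R) f g : 0 < t ->
  (sqsum (f + g)%R <= (1 + t)%:E * sqsum f + (1 + t^-1)%:E * sqsum g)%E.
Proof.
move=> t0; have t1 : 0 <= 1 + t by rewrite addr_ge0// ltW.
have t2 : 0 <= 1 + t^-1 by rewrite addr_ge0// invr_ge0 ltW.
apply: le_trans (leeD (esumZ_le t1 _) (esumZ_le t2 _)).
2,3: by move=> i; exact: sqr_ge0.
rewrite -esumD; last 2 first.
- by move=> i _; rewrite lee_fin mulr_ge0// sqr_ge0.
- by move=> i _; rewrite lee_fin mulr_ge0// sqr_ge0.
apply: le_esum => i _; rewrite -EFinD lee_fin.
set u := nrm (f i); set v := nrm (g i).
apply: (@le_trans _ _ ((u + v) ^+ 2)).
  by rewrite ler_pXn2r ?nnegrE ?addr_ge0 ?nrm_ge0// nrmD.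
have -> : (1 + t) * u ^+ 2 + (1 + t^-1) * v ^+ 2
    = (u + v) ^+ 2 + t^-1 * (t * u - v) ^+ 2.
  by field; exact: lt0r_neq0.
by rewrite lerDl mulr_ge0 ?sqr_ge0// invr_ge0 ltW.
Qed.

Lemma sqsummable_submod : submod_closed sqsummable.
Proof.
split=> [|a f g fs gs].
  rewrite unfold_in /sqsum esum1 ?ltry// => i _.
  by rewrite [nrm _]nrm0 expr0n.
rewrite unfold_in; apply: le_lt_trans (sqsumD_le _ _ ltr01) _.
rewrite lte_add_pinfty// lte_mul_pinfty// ?lee_fin//.
apply: le_lt_trans (sqsumZ_le _ _) _.
by rewrite lte_mul_pinfty// lee_fin sqr_ge0.
Qed.

HB.instance Definition _ := GRing.isSubmodClosed.Build _ _ sqsummable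
  sqsummable_submod.
HB.instance Definition _ := [SubChoice_isSubLmodule of ell2 by <:].


Definition ell2_norm (f : ell2) : R[i] := (Num.sqrt (fine (sqsum f)))%:C.

Lemma ell2P (f : ell2) : ell2_fun f \in sqsummable. Proof. exact: valP. Qed.

Lemma le_sqsum f i : ((nrm (f i) ^+ 2)%:E <= sqsum f)%E.
Proof.
apply: esum_ge; exists [set i]; first by split.
by rewrite fsbig_set1.
Qed.

Lemma ell2_norm0_eq0 (f : ell2) : ell2_norm f = 0 -> f = 0.
Proof.
move=> /complexI/eqP; rewrite sqrtr_eq0 => f0.
apply/val_inj/funext => i /=; apply/nrm0_eq0/eqP.
rewrite -sqrf_eq0 eq_le sqr_ge0 andbT (le_trans _ f0)//.
by rewrite -lee_fin -sqsum_fin ?ell2P// le_sqsum.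
Qed.

Lemma ell2_normZ_le (a : R[i]) (f : ell2) :
  ell2_norm (a *: f) <= `|a| * ell2_norm f.
Proof.
rewrite /ell2_norm [`|a|](_ : _ = (ComplexField.Normc.normc a)%:C)//.
rewrite -rmorphM lecR -[leRHS]ger0_norm; last first.
  by rewrite mulr_ge0 ?sqrtr_ge0//; case: (a) => x y; exact: sqrtr_ge0.
rewrite -sqrtr_sqr ler_wsqrtr// exprMn sqr_sqrtr ?fine_ge0 ?sqsum_ge0//.
by rewrite -lee_fin EFinM -!sqsum_fin ?ell2P// sqsumZ_le.
Qed.

Lemma ell2_normZ (a : R[i]) (f : ell2) :
  ell2_norm (a *: f) = `|a| * ell2_norm f.
Proof.
apply/le_anti; rewrite ell2_normZ_le /=.
have [->|a0] := eqVneq a 0.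
  by rewrite normr0 mul0r /ell2_norm lecR sqrtr_ge0.
rewrite -ler_pdivlMl ?normr_gt0// -normfV.
by rewrite -[X in ell2_norm X](scalerK a0) ell2_normZ_le.
Qed.

Lemma ler_ell2_normD (f g : ell2) :
  ell2_norm (f + g) <= ell2_norm f + ell2_norm g.
Proof.
rewrite /ell2_norm -rmorphD lecR.
set a := Num.sqrt (fine (sqsum f)); set b := Num.sqrt (fine (sqsum g)).
have [a0|a0] := eqVneq a 0.
  have /ell2_norm0_eq0 -> : ell2_norm f = 0 by rewrite /ell2_norm -/a a0.
  by rewrite add0r lerDr sqrtr_ge0.
have [b0|b0] := eqVneq b 0.
  have /ell2_norm0_eq0 -> : ell2_norm g = 0 by rewrite /ell2_norm -/b b0.
  by rewrite addr0 lerDl sqrtr_ge0.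
have ap : 0 < a by rewrite lt_neqAle eq_sym a0 sqrtr_ge0.
have bp : 0 < b by rewrite lt_neqAle eq_sym b0 sqrtr_ge0.
rewrite -[leRHS]ger0_norm ?addr_ge0 ?sqrtr_ge0// -sqrtr_sqr ler_wsqrtr//.
rewrite -lee_fin -sqsum_fin ?ell2P//.
apply: le_trans (sqsumD_le _ _ (divr_gt0 bp ap)) _.
rewrite (sqsum_fin (ell2P f)) (sqsum_fin (ell2P g)) -!EFinM -EFinD lee_fin.
have -> : fine (sqsum f) = a ^+ 2 by rewrite sqr_sqrtr// fine_ge0// sqsum_ge0.
have -> : fine (sqsum g) = b ^+ 2 by rewrite sqr_sqrtr// fine_ge0// sqsum_ge0.
by rewrite le_eqVlt; apply/orP; left; apply/eqP; field; rewrite a0 b0.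
Qed.

HB.instance Definition _ := Lmodule_isNormed.Build R[i] ell2
  ler_ell2_normD ell2_normZ ell2_norm0_eq0.

(* The square-summable family f as an element of ell2 (0 if f is not
   square-summable). *)
Definition to_ell2 (f : I -> V) : ell2 := insubd (0 : ell2) f.

Lemma to_ell2E (f : I -> V) i : f \in sqsummable -> to_ell2 f i = f i.
Proof. by move=> fs; rewrite -[LHS]/(val (to_ell2 f) i) insubdK. Qed.

Lemma sqsum_le (M : R) (f g : I -> V) :
  0 <= M -> (forall i, nrm (g i) <= M * nrm (f i)) ->
  (sqsum g <= (M ^+ 2)%:E * sqsum f)%E.
Proof.
move=> M0 gf; apply: le_trans (esumZ_le _ _); last 2 first.
- exact: sqr_ge0.
- by move=> i; exact: sqr_ge0.
apply: le_esum => i _; rewrite -exprMn lee_fin.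
by rewrite ler_pXn2r ?nnegrE ?mulr_ge0 ?nrm_ge0.
Qed.

Lemma ell2_norm_le (M : R) (f g : ell2) :
  0 <= M -> (forall i, nrm (g i) <= M * nrm (f i)) -> `|g| <= M%:C * `|f|.
Proof.
move=> M0 gf; rewrite -[`|g|]/(ell2_norm g) -[`|f|]/(ell2_norm f) /ell2_norm.
rewrite -rmorphM lecR -[leRHS]ger0_norm ?mulr_ge0 ?sqrtr_ge0// -sqrtr_sqr.
rewrite ler_wsqrtr// exprMn sqr_sqrtr ?fine_ge0 ?sqsum_ge0//.
by rewrite -lee_fin EFinM -!sqsum_fin ?ell2P// sqsum_le.
Qed.

End ell2.
Arguments ell2 {R} I V.

Section bounded_operators.
Context {R : realType} {V W : normedModType R[i]}.

Definition opbound (f : V -> W) (c : R) :=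
  0 <= c /\ forall x, `|f x| <= c%:C * `|x|.

Definition bounded_linear : {pred V -> W} :=
  fun f => `[< linear f /\ exists c, opbound f c >].

Record bop := Bop { bop_fun :> V -> W; _ : bop_fun \in bounded_linear }.

HB.instance Definition _ := [isSub for bop_fun].
HB.instance Definition _ := [Choice of bop by <:].

Lemma bounded_linear_submod : submod_closed bounded_linear.
Proof.
split=> [|a f g /asboolP[fl [c [c0 fc]]] /asboolP[gl [d [d0 gd]]]].
  apply/asboolP; split=> [k x y|]; first by rewrite [RHS]addr0 scaler0.
  by exists 0; split=> // x; rewrite mul0r normr_le0.
apply/asboolP; split=> [k x y|].
  rewrite -[LHS]/(a *: f (k *: x + y) + g (k *: x + y)) (fl k x y) (gl k x y).
  rewrite -[RHS]/(k *: (a *: f x + g x) + (a *: f y + g y)).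
  by rewrite !scalerDr !scalerA [k * a]mulrC addrACA.
exists (ComplexField.Normc.normc a * c + d); split.
  by rewrite addr_ge0 ?mulr_ge0//; case: (a) => x y; exact: sqrtr_ge0.
move=> x; rewrite (le_trans (ler_normD _ _))// rmorphD mulrDl lerD//.
by rewrite normrZ rmorphM -mulrA ler_wpM2l.
Qed.

HB.instance Definition _ := GRing.isSubmodClosed.Build _ _ bounded_linear
  bounded_linear_submod.
HB.instance Definition _ := [SubChoice_isSubLmodule of bop by <:].

Definition op_norm (T : bop) : R[i] := (inf (opbound T))%:C.

Lemma bopP (T : bop) : linear T /\ exists c, opbound T c.
Proof. exact/asboolP/(valP T). Qed.

HB.instance Definition _ (T : bop) :=
  GRing.isLinear.Build R[i] V W *:%R T (bopP T).1.

Lemma opbound_inf (T : bop) : opbound T (inf (opbound T)).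
Proof.
have lb : has_lbound (opbound T) by exists 0 => c [].
have hi : has_inf (opbound T) by split=> //; exact: (bopP T).2.
split; first by apply: lb_le_inf => [|c []//]; exact: (bopP T).2.
move=> x; have [->|x0] := eqVneq x 0; first by rewrite linear0 !normr0 mulr0.
have nx : 0 < nrm x by rewrite -ltcR -nrmE normr_gt0.
rewrite !nrmE -rmorphM lecR -ler_pdivrMr//.
apply: lb_le_inf => [|c [c0 /(_ x)]]; first exact: (bopP T).2.
by rewrite !nrmE -rmorphM lecR ler_pdivrMr.
Qed.

Lemma op_norm_le (T : bop) c : opbound T c -> inf (opbound T) <= c.
Proof. by move=> Tc; apply: ge_inf => //; exists 0 => d []. Qed.

Lemma ler_op_normD (S T : bop) : op_norm (S + T) <= op_norm S + op_norm T.
Proof.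
rewrite /op_norm -rmorphD lecR; apply: op_norm_le.
have [s0 Ss] := opbound_inf S; have [t0 Tt] := opbound_inf T.
split=> [|x]; first exact: addr_ge0.
by rewrite (le_trans (ler_normD _ _))// rmorphD mulrDl lerD.
Qed.

Lemma op_normZ_le (a : R[i]) (T : bop) : op_norm (a *: T) <= `|a| * op_norm T.
Proof.
rewrite /op_norm [`|a|](_ : _ = (ComplexField.Normc.normc a)%:C)//.
rewrite -rmorphM lecR; apply: op_norm_le; have [t0 Tt] := opbound_inf T.
split=> [|x].
  by rewrite mulr_ge0//; case: (a) => x y; exact: sqrtr_ge0.
by rewrite normrZ rmorphM -mulrA ler_wpM2l.
Qed.

Lemma op_normZ (a : R[i]) (T : bop) : op_norm (a *: T) = `|a| * op_norm T.
Proof.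
apply/le_anti; rewrite op_normZ_le /=.
have [->|a0] := eqVneq a 0.
  by rewrite normr0 mul0r /op_norm lecR; case: (opbound_inf (0 *: T)).
rewrite -ler_pdivlMl ?normr_gt0// -normfV.
by rewrite -[X in op_norm X](scalerK a0) op_normZ_le.
Qed.

Lemma op_norm0_eq0 (T : bop) : op_norm T = 0 -> T = 0.
Proof.
move=> /complexI T0; apply/val_inj/funext => x /=; apply/eqP.
by have [_ /(_ x)] := opbound_inf T; rewrite T0 mul0r normr_le0.
Qed.

HB.instance Definition _ := Lmodule_isNormed.Build R[i] bop
  ler_op_normD op_normZ op_norm0_eq0.

(* f as a bounded operator (0 if f is not linear and bounded). *)
Definition to_bop (f : V -> W) : bop := insubd (0 : bop) f.

Lemma to_bopE (f : V -> W) x : f \in bounded_linear -> to_bop f x = f x.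
Proof. by move=> fb; rewrite -[LHS]/(val (to_bop f) x) insubdK. Qed.

End bounded_operators.
Arguments bop {R} V W.

(* Operator spaces are given concretely, as subsets of the bounded operators
   between two spaces.  An element of M_m(B(V, W)) is a matrix of operators;
   amp x is the operator V^m -> W^m it represents, and the norm of that
   operator is the matrix norm. *)
Section operator_spaces.
Context {R : realType}.

Definition amp {V W : normedModType R[i]} {m : nat} (x : 'M[bop V W]_m) :
    bop (ell2 'I_m V) (ell2 'I_m W) :=
  to_bop (fun xi : ell2 'I_m V => to_ell2 (fun i => \sum_j x i j (xi j))).

Definition mx_over {T : Type} (X : set T) {m : nat} : set 'M[T]_m :=
  [set x | forall i j, X (x i j)].

Definition compact_on {E F : normedModType R[i]} (X : set E) (Psi : E -> F) :=
  precompact (Psi @` (X `&` [set x | `|x| <= 1])).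

Definition dist {E : normedModType R[i]} (x : E) (A : set E) : R :=
  inf [set nrm (x - a) | a in A].

Definition finite_dim {E : lmodType R[i]} (Y : set E) :=
  exists n (y : 'I_n -> E),
    Y = [set \sum_k c k *: y k | c in [set: 'I_n -> R[i]]].

Context {V W V' W' : normedModType R[i]}.
Implicit Types (X : set (bop V W)) (Z : set (bop V' W'))
  (Psi : bop V W -> bop V' W').

Definition linear_on X Psi :=
  forall (a : R[i]) x y, X x -> X y -> Psi (a *: x + y) = a *: Psi x + Psi y.

Definition cb_bound X Psi (c : R) :=
  forall m (x : 'M[bop V W]_m), mx_over X x ->
    `|amp (map_mx Psi x)| <= c%:C * `|amp x|.

Definition completely_bounded X Z Psi :=
  [/\ forall x, X x -> Z (Psi x), linear_on X Psi & exists c, cb_bound X Psi c].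

Definition completely_compact X Z Psi :=
  completely_bounded X Z Psi /\
  forall eps : R, 0 < eps -> exists Y : set (bop V' W'),
    [/\ Y `<=` Z, finite_dim Y &
        forall m (x : 'M[bop V W]_m), mx_over X x -> `|amp x| <= 1 ->
          dist (amp (map_mx Psi x)) (amp @` mx_over Y) < eps].

End operator_spaces.

Section ell2_operators.
Context {R : realType} {G : choiceType}.
Local Notation H := (ell2 G R[i]^o).

Definition basis (q : G) : H := to_ell2 (fun p => (p == q)%:R : R[i]^o).

(* The matrix entry x_(p,q) = <x e_q, e_p>. *)
Definition entry (x : bop H H) (p q : G) : R[i] := x (basis q) p.

Definition compact_ops : set (bop H H) := [set T | compact_on setT T].

Definition schur_rel (phi : G -> G -> R[i]) (x y : bop H H) :=
  forall p q, entry y p q = phi q p * entry x p q.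

(* An operator is determined by its matrix, so at most one y satisfies
   schur_rel phi x y. *)
Definition schur_map phi (x : bop H H) : bop H H := xget 0 (schur_rel phi x).

Definition schur_multiplier phi :=
  (forall x, exists y, schur_rel phi x y) /\
  completely_bounded setT setT (schur_map phi).

Definition compact_schur_multiplier phi :=
  schur_multiplier phi /\ compact_on compact_ops (schur_map phi).

Definition c0 : set (G -> R[i]) :=
  [set a | forall eps : R, 0 < eps -> finite_set [set s | eps%:C <= `|a s|]].

Definition mulop (a : G -> R[i]) : bop H H :=
  to_bop (fun xi : H => to_ell2 (fun s => a s * xi s : R[i]^o)).

Definition c0_ops : set (bop H H) := mulop @` c0.

Lemma c0_bounded a : c0 a ->
  exists2 M : R, 0 <= M & forall s, nrm (a s : R[i]^o) <= M.
Proof.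
move=> /(_ 1 ltr01)/finite_seqP[X aX].
have S0 (Y : seq G) : 0 <= \sum_(t <- Y) nrm (a t : R[i]^o).
  by apply: sumr_ge0 => t _; exact: nrm_ge0.
exists (1 + \sum_(t <- X) nrm (a t : R[i]^o)) => [|s]; first exact: addr_ge0.
have [sX|sX] := boolP (s \in X).
  by rewrite (big_rem s)//= addrCA lerDl addr_ge0.
rewrite (@le_trans _ _ 1) ?lerDl// leNgt; apply: contra sX => a1.
suff : [set` X] s by [].
by rewrite -aX /= -[`|a s|](nrmE (a s : R[i]^o)) lecR ltW.
Qed.

Lemma mulopE a (xi : H) s : c0 a -> mulop a xi s = a s * xi s.
Proof.
move=> /c0_bounded[M M0 aM].
have aM' (x : H) t : nrm (a t * x t : R[i]^o) <= M * nrm (x t).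
  by rewrite [nrm _]nrmZ ler_wpM2r ?nrm_ge0//; exact: aM.
have ax (x : H) : (fun t => a t * x t : R[i]^o) \in sqsummable.
  rewrite unfold_in (le_lt_trans (sqsum_le M0 (aM' x)))//.
  by rewrite lte_mul_pinfty ?lee_fin ?sqr_ge0//; exact: ell2P.
rewrite /mulop to_bopE ?to_ell2E//.
apply/asboolP; split=> [k x y|].
  apply/val_inj/funext => t.
  rewrite [LHS](to_ell2E t (ax _)).
  rewrite [RHS](_ : _ = k * (a t * x t) + a t * y t); last first.
    by congr (_ * _ + _); [exact: (to_ell2E t (ax x))|exact: (to_ell2E t (ax y))].
  by rewrite -[LHS]/(a t * (k * x t + y t)) mulrDr mulrCA.
exists M; split=> // x; apply: ell2_norm_le => // t.
by rewrite to_ell2E.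
Qed.

Lemma basisE p q : basis q p = (p == q)%:R.
Proof.
apply: to_ell2E; rewrite unfold_in /sqsum.
rewrite (esumID [set q]) => [|i _]; last by rewrite lee_fin sqr_ge0.
rewrite setTI esum_set1 ?lee_fin ?sqr_ge0// esum1 ?adde0 ?ltry//.
by move=> i [_ /eqP/negbTE ->]; rewrite [nrm _]nrm0 expr0n.
Qed.

(* The map M_a |-> M_(h a) on c0_ops, reading a off as the diagonal of M_a. *)
Definition mulop_lift (h : (G -> R[i]) -> (G -> R[i])) (T : bop H H) :=
  mulop (h (fun s => entry T s s)).

Lemma mulop_liftE h a : c0 a -> mulop_lift h (mulop a) = mulop (h a).
Proof.
move=> a0; rewrite /mulop_lift; congr (mulop (h _)); apply/funext => s.
by rewrite /entry mulopE// basisE eqxx mulr1.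
Qed.

End ell2_operators.

Section crossed_product.
Context {R : realType} {G : groupType} {H : normedModType R[i]}.
Local Notation HG := (ell2 G H).
Variables (A : set (bop H H)) (alpha : G -> bop H H -> bop H H).

Definition translation (t : G) : bop HG HG :=
  to_bop (fun xi : HG => to_ell2 (fun s => xi (t^-1 * s)%g)).

(* The representation a |-> pi(a); integrated is its integrated form on
   l^1(G, A), a norm-convergent sum over the finite subsets of G. *)
Definition cov_rep (a : bop H H) : bop HG HG :=
  to_bop (fun xi : HG => to_ell2 (fun s => alpha (s^-1)%g a (xi s))).

Definition l1 : set (G -> bop H H) :=
  [set f | (forall s, A (f s)) /\ summable setT (fun s => (nrm (f s))%:E)].

Definition integrated (f : G -> bop H H) : bop HG HG :=
  summability.sum (fun s => to_bop (cov_rep (f s) \o translation s)).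

Definition crossed_product : set (bop HG HG) := closure (integrated @` l1).

(* S restricts to S_F on the image of l^1(G, A). *)
Definition herz_schur_rel (F : G -> bop H H -> bop H H)
    (S : bop HG HG -> bop HG HG) :=
  forall f, l1 f -> S (integrated f) = integrated (fun t => F t (f t)).

Definition herz_schur_multiplier (F : G -> bop H H -> bop H H) :=
  [/\ forall s, completely_bounded A A (F s),
      exists c, forall s, cb_bound A (F s) c &
      exists S, herz_schur_rel F S /\
        completely_bounded (integrated @` l1) (integrated @` l1) S].

(* S is the completely bounded extension of S_F to the crossed product; it is
   unique on crossed_product by density. *)
Definition herz_schur_extension F S :=
  herz_schur_rel F S /\ completely_bounded crossed_product crossed_product S.

Definition completely_compact_herz_schur_multiplier F :=
  herz_schur_multiplier F /\
  exists S, herz_schur_extension F S /\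
    completely_compact crossed_product crossed_product S.

End crossed_product.

Definition c0_action {R : realType} {G : groupType} (t : G) :
    bop (ell2 G R[i]^o) (ell2 G R[i]^o) -> bop (ell2 G R[i]^o) (ell2 G R[i]^o) :=
  mulop_lift (fun a s => a (t^-1 * s)%g).

(* Main.v *)
(** The matrix of pi~(f) on l^2(G x G) has entry f(s s'^-1)(s r) at
    ((s, r), (s', r)) and 0 at ((s, r), (s', r')) for r != r'.  Hence S_F
    multiplies this matrix entrywise by phi(s r, s' r'): it is the transpose of
    the Schur multiplier phi, inflated along (s, r) |-> s r.  Grouping vectors by
    the fibres of such a map shows that neither inflation nor amplification
    increases the bound of a Schur multiplier, so S_F is completely bounded.
    Compactness of S_phi gives finite sets s such that (1 - 1_(s x s)) phi is a
    Schur multiplier of norm at most eps, and the inflation of 1_(s x s) phi maps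
    the crossed product into the span of the |s|^2 elements
    pi(M_(delta_p)) lambda_(p q^-1), p, q in s. *)
Require Import Defs.
From HB Require Import structures.
From mathcomp Require Import all_boot all_order all_algebra complex.
From mathcomp Require Import all_classical all_reals all_analysis.
From mathcomp Require Import ring lra.
Import Order.TTheory GRing.Theory Num.Theory.
Import numFieldNormedType.Exports.
Local Open Scope classical_set_scope.
Local Open Scope ring_scope.
Local Open Scope complex_scope.
Set Implicit Arguments.
Unset Strict Implicit.
Unset Printing Implicit Defensive.

(** Compactness of S_phi speaks of single operators, whereas complete compactness asks for one
    subspace that serves every [m]. The gap is bridged by turning compactness into a norm estimate
    for a Schur multiplier: [amp] only adds an index that the multiplier ignores, so the estimate
    passes to every [m] unchanged. To use one argument on l^2(G), on l^2(G, l^2(G)) and on their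
    m-fold sums, all of them are handled through abstract coordinates, and operator norms become
    bounds on finite sections of matrices, for which grouping by fibres is a rearrangement of finite
    sums. The set s consists of the supports of the centres of a finite eps/2-net; the halving pays
    for cutting out the s x s corner, which can double a norm. The inflated corner need not have
    finite rank on all bounded operators of l^2(G x G). It does on the crossed product because an
    entry there depends only on the products (s r, s' r') and on whether r = r', so that |s|^2
    numbers determine the image. *)

Section modulus.
Context {R : realType}.
Implicit Types x y : R[i].

Definition ab x : R := nrm (x : R[i]^o).

Lemma abE x : ab x = ComplexField.Normc.normc x. Proof. by []. Qed.

Lemma ab_ge0 x : 0 <= ab x. Proof. exact: nrm_ge0. Qed.

Lemma normr_ab x : `|x| = (ab x)%:C. Proof. by []. Qed.

Lemma abM x y : ab (x * y) = ab x * ab y.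
Proof. by rewrite /ab -nrmZ. Qed.

Lemma abD x y : ab (x + y) <= ab x + ab y.
Proof. exact: nrmD. Qed.

Lemma ab0 : ab 0 = 0. Proof. exact: nrm0. Qed.

Lemma abN x : ab (- x) = ab x. Proof. by rewrite /ab /nrm normrN. Qed.

Lemma ab_eq0 x : ab x = 0 -> x = 0.
Proof. by move=> x0; apply: nrm0_eq0 (x : R[i]^o) x0. Qed.

Lemma ab1 : ab 1 = 1.
Proof. by rewrite abE /= expr1n expr0n addr0 sqrtr1. Qed.

Lemma abR (a : R) : 0 <= a -> ab a%:C = a.
Proof. by move=> a0; rewrite abE /= expr0n addr0 sqrtr_sqr ger0_norm. Qed.

Lemma ab_sum I (s : seq I) (P : pred I) (f : I -> R[i]) :
  ab (\sum_(i <- s | P i) f i) <= \sum_(i <- s | P i) ab (f i).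
Proof.
elim/big_ind2: _ => [|x a y b xa yb|//]; first by rewrite ab0.
exact: le_trans (abD _ _) (lerD xa yb).
Qed.

Lemma ab_conj x : ab x^* = ab x.
Proof. by case: x => a b; rewrite !abE /= sqrrN. Qed.

Lemma mul_conj_ab x : x * x^* = (ab x ^+ 2)%:C.
Proof.
case: x => a b; rewrite abE /= sqr_sqrtr ?addr_ge0 ?sqr_ge0//.
by apply/eqP; rewrite eq_complex /=; apply/andP; split; apply/eqP; ring.
Qed.

End modulus.

(** * Finite sums and their regrouping along the fibres of a map *)

Lemma big_seq_pred1 {V : nmodType} {I : eqType} (t : seq I) (f : I -> V) x :
  uniq t -> x \in t -> \sum_(i <- t | i == x) f i = f x.
Proof.
by move=> ut xt; rewrite -big_filter (filter_pred1_uniq ut xt) big_seq1.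
Qed.

Lemma ler_sum_sub {R : numDomainType} {I : eqType} (s t : seq I) (f : I -> R) :
  (forall i, 0 <= f i) -> uniq s -> uniq t -> {subset s <= t} ->
  \sum_(i <- s) f i <= \sum_(i <- t) f i.
Proof.
move=> f0 us ut st; have sp : perm_eq [seq i <- t | i \in s] s.
  apply: uniq_perm; rewrite ?filter_uniq// => i; rewrite mem_filter.
  by case: (boolP (i \in s)) => //= /st.
rewrite [leRHS](bigID (mem s))/= -[X in _ <= X + _]big_filter (perm_big _ sp)/=.
by rewrite lerDl sumr_ge0.
Qed.

Lemma big_fibres {V : nmodType} {I : Type} {K : eqType} (h : I -> K)
    (t : seq K) (s : seq I) (f : I -> K -> V) : uniq t ->
  \sum_(g <- t) \sum_(p <- s | h p == g) f p g =
  \sum_(p <- s | h p \in t) f p (h p).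
Proof.
move=> ut; rewrite (exchange_big_dep xpredT)//= [RHS]big_mkcond.
apply: eq_bigr => p _; case: ifPn => [ht|/negP ht].
  by under eq_bigl do rewrite eq_sym; rewrite big_seq_pred1.
by rewrite big_seq_cond big1// => g /andP[+ /eqP hg]; rewrite -hg.
Qed.

Lemma big_undup_fibres {V : nmodType} {I : eqType} {K : eqType} (h : I -> K)
    (s : seq I) (f : I -> K -> V) :
  \sum_(p <- s) f p (h p) =
  \sum_(g <- undup (map h s)) \sum_(p <- s | h p == g) f p g.
Proof.
rewrite big_fibres ?undup_uniq// [LHS]big_seq [RHS]big_seq_cond.
apply: eq_bigl => p; case: (boolP (p \in s)) => //= ps.
by rewrite mem_undup map_f.
Qed.

(** * Bounded matrices and Schur multipliers acting on them *)

Section matrix_bound.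
Context {R : realType}.
Local Notation C := R[i].

Definition sqs {I : Type} (s : seq I) (f : I -> C) : R :=
  \sum_(p <- s) ab (f p) ^+ 2.

Lemma sqs_ge0 I (s : seq I) f : 0 <= sqs s f.
Proof. by apply: sumr_ge0 => p _; exact: sqr_ge0. Qed.

(* The matrix k defines an operator l^2(J) -> l^2(I) of norm at most c.  The
   sesquilinear bound is stated without square roots; it is equivalent by
   homogeneity. *)
Definition mbound {I J : choiceType} (k : I -> J -> C) (c : R) :=
  0 <= c /\ forall s t (eta : I -> C) (xi : J -> C), uniq s -> uniq t ->
    2 * ab (\sum_(p <- s) \sum_(q <- t) k p q * xi q * eta p)
      <= c * (sqs s eta + sqs t xi).

Section theory.
Context {I J : choiceType}.
Implicit Types (k : I -> J -> C) (c : R).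

Lemma mbound_le k c d : c <= d -> mbound k c -> mbound k d.
Proof.
move=> cd [c0 kc]; split=> [|s t eta xi us ut]; first exact: le_trans c0 cd.
by apply: le_trans (kc _ _ _ _ us ut) _; rewrite ler_wpM2r// addr_ge0 ?sqs_ge0.
Qed.

Lemma eq_mbound k k' c : (forall p q, k p q = k' p q) -> mbound k c -> mbound k' c.
Proof.
move=> kk'; have -> // : k = k'.
by apply/funext => p; apply/funext => q; exact: kk'.
Qed.

Lemma mbound_tr k c : mbound k c -> mbound (fun q p => k p q) c.
Proof.
move=> [c0 kc]; split=> // s t eta xi us ut.
rewrite exchange_big/= [sqs s eta + _]addrC.
apply: (le_trans _ (kc _ _ xi eta ut us)).
rewrite le_eqVlt; apply/orP; left; apply/eqP; congr (_ * ab _).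
by apply: eq_bigr => p _; apply: eq_bigr => q _; rewrite mulrAC.
Qed.

Lemma mbound0 : mbound (fun (_ : I) (_ : J) => 0) 0.
Proof.
split=> // s t eta xi _ _; rewrite mul0r big1 ?ab0 ?mulr0// => p _.
by rewrite big1// => q _; rewrite !mul0r.
Qed.

Lemma mboundD k k' c d : mbound k c -> mbound k' d ->
  mbound (fun p q => k p q + k' p q) (c + d).
Proof.
move=> [c0 kc] [d0 kd]; split=> [|s t eta xi us ut]; first exact: addr_ge0.
under eq_bigr do under eq_bigr do rewrite !mulrDl.
under eq_bigr do rewrite big_split/=.
rewrite big_split/= [leRHS]mulrDl.
apply: (le_trans _ (lerD (kc _ _ _ _ us ut) (kd _ _ _ _ us ut))).
by rewrite -mulrDr ler_wpM2l// abD.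
Qed.

Lemma mboundZ k c a : mbound k c -> mbound (fun p q => a * k p q) (ab a * c).
Proof.
move=> [c0 kc]; split=> [|s t eta xi us ut]; first by rewrite mulr_ge0 ?ab_ge0.
under eq_bigr do under eq_bigr do rewrite -!mulrA.
under eq_bigr do rewrite -mulr_sumr.
rewrite -mulr_sumr abM mulrCA -mulrA ler_wpM2l ?ab_ge0//.
under eq_bigr do under eq_bigr do rewrite mulrA.
exact: kc.
Qed.

Lemma mbound_sum (T : Type) (r : seq T) (k : T -> I -> J -> C) (c : T -> R) :
  (forall i, mbound (k i) (c i)) ->
  mbound (fun p q => \sum_(i <- r) k i p q) (\sum_(i <- r) c i).
Proof.
move=> kc; elim: r => [|i r IH].
  by rewrite big_nil; apply: eq_mbound mbound0 => p q; rewrite big_nil.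
rewrite big_cons; apply: eq_mbound (mboundD (kc i) IH) => p q.
by rewrite big_cons.
Qed.

(** Each instance of the bound involves a finite rectangle of entries, so the comparison matrix [k']
    may vary with the rectangle as long as [c] does not. *)
Lemma mbound_local k c : 0 <= c ->
  (forall s t, uniq s -> uniq t -> exists2 k', mbound k' c &
     forall p q, p \in s -> q \in t -> k p q = k' p q) -> mbound k c.
Proof.
move=> c0 kc; split=> // s t eta xi us ut.
have [k' [_ k'c] kk'] := kc _ _ us ut.
apply: (le_trans _ (k'c _ _ _ _ us ut)); rewrite le_eqVlt; apply/orP; left.
apply/eqP; congr (_ * ab _); rewrite big_seq [RHS]big_seq.
apply: eq_bigr => p ps; rewrite big_seq [RHS]big_seq.
by apply: eq_bigr => q qt; rewrite kk'.
Qed.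

(** The vectors are pushed forward along [f] and [g]; [ex] sums over a preimage, which by
    injectivity has at most one point, so no mass is merged. *)
Lemma mbound_inj {I' J' : choiceType} (f : I' -> I) (g : J' -> J) k c :
  injective f -> injective g ->
  mbound k c -> mbound (fun p q => k (f p) (g q)) c.
Proof.
move=> fI gI [c0 kc]; split=> // s t eta xi us ut.
pose ex (A B : choiceType) (h : A -> B) (u : seq A) (z : A -> C) b :=
  \sum_(a <- u | h a == b) z a.
have exE (A B : choiceType) (h : A -> B) u z a : injective h -> uniq u ->
    a \in u -> ex A B h u z (h a) = z a.
  move=> hI uu au; rewrite /ex (eq_bigl (pred1 a)); last first.
    by move=> b /=; apply/eqP/eqP => [/hI|->].
  exact: big_seq_pred1.
have := kc (map f s) (map g t) (ex _ _ f s eta) (ex _ _ g t xi).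
rewrite !map_inj_uniq// => /(_ us ut); rewrite /sqs !big_map.
rewrite !(big_seq_cond (fun=> true)).
under eq_bigr => p /andP[ps _].
  rewrite big_map big_seq; under eq_bigr => q qt.
    rewrite (exE _ _ _ _ _ _ gI ut qt) (exE _ _ _ _ _ _ fI us ps); over.
  rewrite -big_seq; over.
rewrite (eq_bigr (fun p => ab (eta p) ^+ 2)); last first.
  by move=> p /andP[ps _]; rewrite exE.
rewrite (eq_bigr (fun p => ab (xi p) ^+ 2)); last first.
  by move=> p /andP[ps _]; rewrite exE.
by [].
Qed.

(** With u the image of [xi], testing against r times the conjugate of u gives 2 r |u|^2 <= c (r^2
    |u|^2 + |xi|^2). The choice r = 1/c is optimal; r = 1 settles c = 0. *)
Lemma mbound_apply k c s t xi : mbound k c -> uniq s -> uniq t ->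
  sqs s (fun p => \sum_(q <- t) k p q * xi q) <= c ^+ 2 * sqs t xi.
Proof.
move=> [c0 kc] us ut; set u := fun p => _.
have H (r : R) : 0 <= r -> 2 * (r * sqs s u) <= c * (r ^+ 2 * sqs s u + sqs t xi).
  move=> r0; have := kc s t (fun p => r%:C * (u p)^*) xi us ut.
  under eq_bigr do rewrite -mulr_suml mulrCA mul_conj_ab.
  rewrite -mulr_sumr -rmorph_sum -rmorphM abR ?mulr_ge0 ?sqs_ge0//.
  rewrite (_ : sqs s (fun p => r%:C * _) = r ^+ 2 * sqs s u)// /sqs mulr_sumr.
  by apply: eq_bigr => p _; rewrite abM abR// ab_conj exprMn.
have := sqs_ge0 s u; have := sqs_ge0 t xi; move: (sqs _ _) (sqs _ _) H => X U H.
move=> X0 U0; have [c0'|c0'] := eqVneq c 0.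
  by have := H 1 ler01; rewrite c0' !mul0r mul1r expr0n mul0r; lra.
have cp : 0 < c by rewrite lt_neqAle eq_sym c0'.
have := H c^-1; rewrite invr_ge0 => /(_ c0).
rewrite -(ler_pM2l cp) => {}H.
have : c * (2 * (c^-1 * U)) = 2 * U by field.
have : c * (c * (c^-1 ^+ 2 * U + X)) = U + c ^+ 2 * X by field.
by move: H => /[swap] -> /[swap] ->; lra.
Qed.

(** Converse of [mbound_apply], by 2 x y <= x^2 / c + c y^2 at each index. When c = 0 the image
    vector vanishes on [s]. *)
Lemma apply_mbound k c : 0 <= c -> (forall s t xi, uniq s -> uniq t ->
    sqs s (fun p => \sum_(q <- t) k p q * xi q) <= c ^+ 2 * sqs t xi) ->
  mbound k c.
Proof.
move=> c0 H; split=> // s t eta xi us ut; have := H _ _ xi us ut.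
set u := fun p => _ => {}H.
under eq_bigr do rewrite -mulr_suml -/(u _).
have [c0'|c0'] := eqVneq c 0.
  have u0 p : p \in s -> ab (u p) = 0.
    move=> ps; apply/eqP; rewrite -sqrf_eq0 eq_le sqr_ge0 andbT.
    move: H; rewrite c0' expr0n mul0r; apply: le_trans.
    rewrite /sqs (big_rem p ps)/= lerDl.
    by apply: sumr_ge0 => ? _; exact: sqr_ge0.
  rewrite big_seq big1 ?ab0 ?mulr0 ?mulr_ge0 ?addr_ge0 ?sqs_ge0// => p /u0 /ab_eq0 up.
  by rewrite [X in X * _]up mul0r.
have cp : 0 < c by rewrite lt_neqAle eq_sym c0'.
apply: (@le_trans _ _ (c^-1 * sqs s u + c * sqs s eta)); last first.
  rewrite mulrDr addrC lerD2l; apply: (@le_trans _ _ (c^-1 * (c ^+ 2 * sqs t xi))).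
    by rewrite ler_wpM2l ?invr_ge0.
  by rewrite expr2 -mulrA mulKf.
apply: (@le_trans _ _ (\sum_(p <- s) 2 * (ab (u p) * ab (eta p)))).
  rewrite -mulr_sumr ler_wpM2l//; apply: le_trans (ab_sum _ _ _) _.
  by apply: ler_sum => p _; rewrite abM.
rewrite /sqs !mulr_sumr -big_split/=; apply: ler_sum => p _.
set x := ab _; set y := ab _; rewrite -subr_ge0.
have -> : c^-1 * x ^+ 2 + c * y ^+ 2 - 2 * (x * y) = c^-1 * (x - c * y) ^+ 2.
  by field.
by rewrite mulr_ge0 ?sqr_ge0// invr_ge0.
Qed.

Lemma mbound_entry k c p q : mbound k c -> ab (k p q) <= c.
Proof.
move=> [_ kc]; have := kc [:: p] [:: q] (fun=> 1) (fun=> 1) isT isT.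
by rewrite /sqs !big_seq1 !mulr1 ab1 expr1n; lra.
Qed.

End theory.

(** Entrywise multiplication by [chi] has norm at most [M] on bounded matrices. Only matrices over
    [G] itself are quantified over; other index sets, including those of amplifications, are reached
    by inflation. *)
Definition schurb {G : choiceType} (chi : G -> G -> C) (M : R) :=
  0 <= M /\ forall k c, mbound k c -> mbound (fun p q => chi p q * k p q) (M * c).

Lemma schurb_tr {G : choiceType} (chi : G -> G -> C) M :
  schurb chi M -> schurb (fun p q => chi q p) M.
Proof.
move=> [M0 H]; split=> // k c kc; apply: (@mbound_tr G G (fun q p => chi q p * k p q)).
exact/H/mbound_tr.
Qed.

Lemma mbound_unit {G : choiceType} (g h : G) :
  mbound (fun p q => ((p == g) && (q == h))%:R) 1.
Proof.
apply: apply_mbound => // s t xi us ut; rewrite expr1n mul1r.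
have E p : \sum_(q <- t) ((p == g) && (q == h))%:R * xi q =
    (p == g)%:R * \sum_(q <- t | q == h) xi q.
  rewrite mulr_sumr [RHS]big_mkcond; apply: eq_bigr => q _.
  by case: eqP; case: eqP; rewrite /= ?mul0r// mulr1.
under [X in X <= _]eq_bigr do rewrite E abM exprMn.
rewrite -mulr_suml; have s1 : \sum_(p <- s) ab ((p == g)%:R : C) ^+ 2 <= 1.
  rewrite (bigID (pred1 g))/= [X in _ + X]big1 ?addr0; last first.
    by move=> p /negbTE ->; rewrite ab0 expr0n.
  have [gs|gs] := boolP (g \in s).
    by rewrite big_seq_pred1// eqxx ab1 expr1n.
  rewrite big_seq_cond big1// => p /andP[ps /eqP pg].
  by rewrite pg (negbTE gs) in ps.
apply: le_trans (ler_wpM2r (sqr_ge0 _) s1) _; rewrite mul1r.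
have [ht|ht] := boolP (h \in t).
  rewrite big_seq_pred1// /sqs (big_rem h ht)/= lerDl.
  by apply: sumr_ge0 => ? _; exact: sqr_ge0.
rewrite big_seq_cond big1 ?ab0 ?expr0n ?sqs_ge0// => p /andP[pt /eqP ph].
by rewrite ph (negbTE ht) in pt.
Qed.

Lemma schurb_le {G : choiceType} (chi : G -> G -> C) M p q :
  schurb chi M -> ab (chi p q) <= M.
Proof.
move=> [M0 /(_ _ _ (mbound_unit p q)) /(mbound_entry p q)].
by rewrite !eqxx !mulr1.
Qed.

(** * Inflation of Schur multipliers along maps of index sets *)

Section inflation.
Context {G I J : choiceType} (sigma : I -> G) (tau : J -> G).

Definition fibre_norm {K : choiceType} (h : K -> G) (t : seq K) (xi : K -> C) g : R :=
  Num.sqrt (\sum_(q <- t | h q == g) ab (xi q) ^+ 2).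

Lemma fibre_norm_sqr {K : choiceType} (h : K -> G) t xi g :
  fibre_norm h t xi g ^+ 2 = \sum_(q <- t | h q == g) ab (xi q) ^+ 2.
Proof. by rewrite sqr_sqrtr//; apply: sumr_ge0 => q _; exact: sqr_ge0. Qed.

(** Where the fibre norm is 0 the quotient is 0 by convention, and so is [xi q]; hence normalising
    and rescaling loses nothing on any fibre. *)
Lemma fibre_normK {K : choiceType} (h : K -> G) t xi q : q \in t ->
  xi q / (fibre_norm h t xi (h q))%:C * (fibre_norm h t xi (h q))%:C = xi q.
Proof.
move=> qt; have [x0|x0] := eqVneq (fibre_norm h t xi (h q)) 0; last first.
  by rewrite mulfVK// (inj_eq (@complexI R)).
rewrite x0 mulr0; apply/esym/ab_eq0/eqP; rewrite -sqrf_eq0 eq_le sqr_ge0 andbT.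
have s0 : \sum_(p <- t | h p == h q) ab (xi p) ^+ 2 <= 0.
  by rewrite -fibre_norm_sqr x0 expr0n.
apply: (le_trans _ s0).
rewrite (big_rem q qt)/= eqxx lerDl.
by apply: sumr_ge0 => ? _; exact: sqr_ge0.
Qed.

Lemma sqs_fibre_norm {K : choiceType} (h : K -> G) t xi :
  sqs (undup (map h t)) (fun g => (fibre_norm h t xi g)%:C) = sqs t xi.
Proof.
rewrite /sqs [RHS](big_undup_fibres h t (fun p _ => ab (xi p) ^+ 2)).
by apply: eq_bigr => g _; rewrite abR ?sqrtr_ge0// fibre_norm_sqr.
Qed.

(** The lift of a vector [z] over [G]: on the fibre above g it is [z g] times the normalised
    restriction of [xi]. These restrictions are orthogonal with norm 0 or 1, so the lift is a
    contraction. *)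
Definition fibre_unit {K : choiceType} (h : K -> G) t xi (u : seq G) z q : C :=
  if h q \in u then xi q / (fibre_norm h t xi (h q))%:C * z (h q) else 0.

Lemma sqs_fibre_unit {K : choiceType} (h : K -> G) t xi u z : uniq u ->
  sqs t (fibre_unit h t xi u z) <= sqs u z.
Proof.
move=> uu; pose f q g := ab (xi q / (fibre_norm h t xi g)%:C * z g) ^+ 2.
rewrite /sqs; have -> : \sum_(q <- t) ab (fibre_unit h t xi u z q) ^+ 2 =
    \sum_(g <- u) \sum_(q <- t | h q == g) f q g.
  rewrite big_fibres// [RHS]big_mkcond; apply: eq_bigr => q _.
  by rewrite /fibre_unit; case: ifP => //; rewrite ab0 expr0n.
apply: ler_sum => g _; rewrite /f.
under eq_bigr do rewrite !abM !exprMn; rewrite -!mulr_suml -fibre_norm_sqr.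
set r := fibre_norm _ _ _ _; have r0 : 0 <= r by exact: sqrtr_ge0.
have [->|rn] := eqVneq r 0; first by rewrite expr0n !mul0r sqr_ge0.
by rewrite -fmorphV abR ?invr_ge0// exprVn mulfV ?mul1r// sqrf_eq0.
Qed.

(* Smith's lemma: normalising the two vectors on the fibres of sigma and tau
   compresses k to a matrix over G with the same bound. *)
Lemma schurb_inflate chi M (k : I -> J -> C) c : schurb chi M -> mbound k c ->
  mbound (fun p q => chi (sigma p) (tau q) * k p q) (M * c).
Proof.
move=> [M0 chiM] kc; have [c0 kc'] := kc.
split=> [|s t eta xi us ut]; first exact: mulr_ge0.
pose k' g h : C := \sum_(p <- s | sigma p == g) \sum_(q <- t | tau q == h)
  k p q * (xi q / (fibre_norm tau t xi h)%:C) * (eta p / (fibre_norm sigma s eta g)%:C).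
have k'c : mbound k' c.
  split=> // u v y x uu uv.
  apply: (le_trans _ (ler_wpM2l c0 (lerD (sqs_fibre_unit sigma s eta y uu)
    (sqs_fibre_unit tau t xi x uv)))).
  apply: (le_trans _ (kc' _ _ _ _ us ut)); rewrite le_eqVlt; apply/orP; left.
  apply/eqP; congr (_ * ab _).
  transitivity (\sum_(g <- u) \sum_(p <- s | sigma p == g) \sum_(h <- v)
      \sum_(q <- t | tau q == h) k p q * (xi q / (fibre_norm tau t xi h)%:C * x h)
        * (eta p / (fibre_norm sigma s eta g)%:C * y g)).
    apply: eq_bigr => g _; rewrite exchange_big/=; apply: eq_bigr => h _.
    rewrite /k' !mulr_suml; apply: eq_bigr => p _.
    by rewrite !mulr_suml; apply: eq_bigr => q _; ring.
  rewrite big_fibres// [LHS]big_mkcond; apply: eq_bigr => p _.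
  rewrite big_fibres// /fibre_unit; case: ifP => _; last first.
    by rewrite big1// => q _; rewrite mulr0.
  rewrite [LHS]big_mkcond; apply: eq_bigr => q _.
  by case: ifP => _; rewrite ?mulr0 ?mul0r.
(* The compressed matrix is tested on the fibre norms of [eta] and [xi], whose square sums are those
   of [eta] and [xi] themselves. *)
have [_ H] := chiM _ _ k'c; rewrite -(sqs_fibre_norm sigma) -(sqs_fibre_norm tau).
apply: (le_trans _ (H _ _ _ _ (undup_uniq _) (undup_uniq _))).
rewrite le_eqVlt; apply/orP; left; apply/eqP; congr (_ * ab _).
transitivity (\sum_(g <- undup (map sigma s)) \sum_(p <- s | sigma p == g)
   \sum_(h <- undup (map tau t)) \sum_(q <- t | tau q == h)
   chi g h * k p q * (xi q / (fibre_norm tau t xi h)%:C * (fibre_norm tau t xi h)%:C)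
     * (eta p / (fibre_norm sigma s eta g)%:C * (fibre_norm sigma s eta g)%:C)).
  rewrite -(big_undup_fibres sigma s (fun p g => \sum_(h <- undup (map tau t))
    \sum_(q <- t | tau q == h) chi g h * k p q *
    (xi q / (fibre_norm tau t xi h)%:C * (fibre_norm tau t xi h)%:C)
     * (eta p / (fibre_norm sigma s eta g)%:C * (fibre_norm sigma s eta g)%:C))).
  rewrite big_seq [RHS]big_seq; apply: eq_bigr => p ps.
  rewrite -(big_undup_fibres tau t (fun q h => chi (sigma p) h * k p q *
    (xi q / (fibre_norm tau t xi h)%:C * (fibre_norm tau t xi h)%:C)
     * (eta p / (fibre_norm sigma s eta (sigma p))%:C
     * (fibre_norm sigma s eta (sigma p))%:C))).
  rewrite big_seq [RHS]big_seq; apply: eq_bigr => q qt.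
  by rewrite !fibre_normK.
apply: eq_bigr => g _; rewrite exchange_big/=; apply: eq_bigr => h _.
rewrite /k' mulr_sumr !mulr_suml; apply: eq_bigr => p _.
by rewrite mulr_sumr !mulr_suml; apply: eq_bigr => q _; ring.
Qed.

End inflation.
End matrix_bound.

(** * Unconditional sums over an arbitrary index set *)

Section unconditional_limits.
Context {R : realType} {I : choiceType}.
Local Notation C := R[i].

Lemma le_esum_seq (s : seq I) (a : I -> R) : uniq s ->
  ((\sum_(i <- s) a i)%:E <= \esum_(i in [set: I]) (a i)%:E)%E.
Proof.
move=> us; apply: esum_ge; exists [set` s]; first by split.
by rewrite -fsbig_seq// sumEFin.
Qed.

Lemma esum_le_seq (M : R) (a : I -> R) :
  (forall s, uniq s -> \sum_(i <- s) a i <= M) ->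
  (\esum_(i in [set: I]) (a i)%:E <= M%:E)%E.
Proof.
move=> aM; apply: ge_ereal_sup => _ [A [/finite_seqP[s ->] _] <-].
have -> : [set` s] = [set` undup s].
  by apply/seteqP; split=> x /=; rewrite mem_undup.
by rewrite -fsbig_seq ?undup_uniq// sumEFin lee_fin aM ?undup_uniq.
Qed.

Lemma sqs_le_sqsum (s : seq I) (f : I -> C) : uniq s ->
  ((sqs s f)%:E <= sqsum (f : I -> C^o))%E.
Proof. exact: le_esum_seq. Qed.

Lemma sqsum_le_sqs (M : R) (f : I -> C) :
  (forall s, uniq s -> sqs s f <= M) -> (sqsum (f : I -> C^o) <= M%:E)%E.
Proof. exact: esum_le_seq. Qed.

(** Convergence of the net of finite partial sums ordered by inclusion, finite sets being
    represented by duplicate-free sequences. *)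
Definition sums_to (f : I -> C) (v : C) := forall eps : R, 0 < eps ->
  exists s0 : seq I, forall s, uniq s -> {subset s0 <= s} ->
    ab (\sum_(i <- s) f i - v) <= eps.

Lemma sums_to_unique f v w : sums_to f v -> sums_to f w -> v = w.
Proof.
move=> fv fw; apply/eqP; rewrite -subr_eq0; apply/eqP/ab_eq0.
apply/eqP; rewrite eq_le ab_ge0 andbT; apply/ler_addgt0Pr => e e0.
have e2 : 0 < e / 2 by rewrite divr_gt0.
have [s0 Hs] := fv _ e2; have [t0 Ht] := fw _ e2.
pose u := undup (s0 ++ t0); have uu : uniq u by exact: undup_uniq.
have su : {subset s0 <= u} by move=> x xs; rewrite mem_undup mem_cat xs.
have tu : {subset t0 <= u} by move=> x xs; rewrite mem_undup mem_cat xs orbT.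
have -> : v - w = (\sum_(i <- u) f i - w) - (\sum_(i <- u) f i - v) by ring.
rewrite add0r [e]splitr; apply: le_trans (abD _ _) _.
apply: lerD; first exact: Ht.
by rewrite abN; exact: Hs.
Qed.

Lemma sums_toD f g v w : sums_to f v -> sums_to g w -> sums_to (fun i => f i + g i) (v + w).
Proof.
move=> fv gw e e0; have e2 : 0 < e / 2 by rewrite divr_gt0.
have [s0 Hs] := fv _ e2; have [t0 Ht] := gw _ e2.
exists (s0 ++ t0) => u uu su; rewrite big_split/=.
rewrite (_ : _ - _ = (\sum_(i <- u) f i - v) + (\sum_(i <- u) g i - w)); last by ring.
rewrite [e]splitr; apply: le_trans (abD _ _) _; apply: lerD.
  by apply: Hs => // x xs; apply: su; rewrite mem_cat xs.
by apply: Ht => // x xs; apply: su; rewrite mem_cat xs orbT.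
Qed.

Lemma sums_toZ a f v : sums_to f v -> sums_to (fun i => a * f i) (a * v).
Proof.
move=> fv e e0; have d0 : 0 < e / (ab a + 1).
  by rewrite divr_gt0// ltr_wpDl ?ab_ge0.
have [s0 Hs] := fv _ d0; exists s0 => s us ss.
rewrite -mulr_sumr -mulrBr abM; apply: le_trans (ler_wpM2l (ab_ge0 _) (Hs s us ss)) _.
rewrite mulrCA ger_pMr// ler_pdivrMr ?ltr_wpDl ?ab_ge0//.
by rewrite mul1r lerDl.
Qed.

Lemma sums_to_finite f (q : I) : (forall i, i != q -> f i = 0) -> sums_to f (f q).
Proof.
move=> fq e e0; exists [:: q] => s us sq; rewrite (bigD1_seq q)/= ?sq ?mem_head//.
by rewrite big1// addr0 subrr ab0 ltW.
Qed.

Lemma nneg_sums_to (r : I -> R) M : (forall i, 0 <= r i) ->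
  (forall s, uniq s -> \sum_(i <- s) r i <= M) ->
  exists v : R, sums_to (fun i => (r i)%:C) v%:C.
Proof.
move=> r0 rM; pose A := [set \sum_(i <- s) r i | s in [set s : seq I | uniq s]].
have supA : has_sup A.
  by split; [exists (\sum_(i <- [::]) r i), [::]|exists M => _ [s us <-]; exact: rM].
exists (sup A) => e e0; have [_ [s0 us0 <-] supe] := sup_adherent e0 supA.
exists s0 => s us ss; rewrite -rmorph_sum -rmorphB -abN -rmorphN opprB.
have le : \sum_(i <- s) r i <= sup A by apply: ub_le_sup; [exact: supA.2|exists s].
rewrite abR ?subr_ge0// lerBlDr -lerBlDl; apply/ltW/(lt_le_trans supe).
exact: ler_sum_sub.
Qed.

(** Adding |f| to the real and to the imaginary part gives nonnegative families with bounded partial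
    sums, which converge to their suprema; the sum of |f| is then subtracted again. *)
Lemma abs_sums_to (f : I -> C) M : (forall s, uniq s -> \sum_(i <- s) ab (f i) <= M) ->
  exists v, sums_to f v.
Proof.
move=> fM; have reim (z : C) : `|complex.Re z| <= ab z /\ `|complex.Im z| <= ab z.
  case: z => a b; rewrite abE /=.
  by split; rewrite -sqrtr_sqr ler_wsqrtr// ?lerDl ?lerDr sqr_ge0.
have M2 (g : I -> R) : (forall i, `|g i| <= ab (f i)) ->
    exists v : R, sums_to (fun i => (g i + ab (f i))%:C) v%:C.
  move=> gf; apply: (@nneg_sums_to _ (M + M)) => [i|s us].
    by have := gf i; rewrite ler_norml; lra.
  rewrite big_split/= lerD ?fM//; apply: le_trans (fM s us).
  by apply: ler_sum => i _; apply: le_trans (gf i); exact: ler_norm.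
have [v0 H0] := nneg_sums_to (fun i => ab_ge0 (f i)) fM.
have [v1 H1] := M2 _ (fun i => (reim (f i)).1).
have [v2 H2] := M2 _ (fun i => (reim (f i)).2).
exists ((v1%:C + -1 * v0%:C) + 'i%C * (v2%:C + -1 * v0%:C)).
have := sums_toD (sums_toD H1 (sums_toZ (-1) H0)) (sums_toZ 'i%C (sums_toD H2 (sums_toZ (-1) H0))).
congr sums_to; apply/funext => i; rewrite [RHS]complexE !rmorphD; ring.
Qed.

End unconditional_limits.

(** * Spaces identified with l^2(I) through coordinates *)

Section coordinates.
Context {R : realType}.
Local Notation C := R[i].

(** A unitary identification of [V] with l^2(I): [co] is linear, isometric, and onto the families
    with bounded finite square sums. The last clause stands in for completeness whenever a vector
    has to be constructed. *)
Definition coordinates {V : normedModType C} {I : choiceType} (co : V -> I -> C) :=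
  [/\ forall a x y i, co (a *: x + y) i = a * co x i + co y i,
      forall x, sqsum (co x : I -> C^o) = (nrm x ^+ 2)%:E &
      forall f M, (forall s, uniq s -> sqs s f <= M) -> exists x, co x = f].

Lemma nrm_ell2 {I : choiceType} {V : normedModType C} (f : ell2 I V) :
  (nrm f ^+ 2)%:E = sqsum f.
Proof.
rewrite /nrm -[ `|f| ]/(ell2_norm f) /= sqr_sqrtr ?fine_ge0 ?sqsum_ge0//.
by rewrite -sqsum_fin ?ell2P.
Qed.

Lemma sqsummableP {I : choiceType} {V : normedModType C} (f : I -> V) (M : R) :
  (sqsum f <= M%:E)%E -> f \in sqsummable.
Proof. by move=> fM; rewrite unfold_in (le_lt_trans fM)// ltry. Qed.

Lemma coordinates_ell2 {I : choiceType} :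
  coordinates (fun (x : ell2 I C^o) i => x i : C).
Proof.
split=> // [x|f M /sqsum_le_sqs/sqsummableP fM]; first by rewrite nrm_ell2.
by exists (to_ell2 (f : I -> C^o)); apply/funext => i; rewrite to_ell2E.
Qed.

Section coordinate_theory.
Context {V : normedModType C} {I : choiceType} {co : V -> I -> C}.
Hypothesis coP : coordinates co.

Lemma coD x y i : co (x + y) i = co x i + co y i.
Proof. by case: coP => + _ _ => /(_ 1 x y i); rewrite scale1r mul1r. Qed.

Lemma co0 i : co 0 i = 0.
Proof. by apply: (addrI (co 0 i)); rewrite -coD !addr0. Qed.

Lemma coZ a x i : co (a *: x) i = a * co x i.
Proof. by case: coP => + _ _ => /(_ a x 0 i); rewrite addr0 co0 addr0. Qed.

Lemma coB x y i : co (x - y) i = co x i - co y i.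
Proof. by rewrite coD -scaleN1r coZ mulN1r. Qed.

Lemma co_sum J (s : seq J) (f : J -> V) i :
  co (\sum_(j <- s) f j) i = \sum_(j <- s) co (f j) i.
Proof.
by elim/big_rec2: _ => [|j y x _ <-]; [exact: co0|rewrite coD].
Qed.

Lemma sqs_nrm x s : uniq s -> sqs s (co x) <= nrm x ^+ 2.
Proof.
by move=> us; case: coP => _ + _ => /(_ x) nx; rewrite -lee_fin -nx sqs_le_sqsum.
Qed.

Lemma nrm_sqs x M : 0 <= M -> (forall s, uniq s -> sqs s (co x) <= M ^+ 2) -> nrm x <= M.
Proof.
move=> M0 /sqsum_le_sqs; case: coP => _ -> _.
by rewrite lee_fin ler_pXn2r ?nnegrE ?nrm_ge0.
Qed.

Lemma ab_co x i : ab (co x i) <= nrm x.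
Proof.
have := @sqs_nrm x [:: i] isT; rewrite /sqs big_seq1.
by rewrite ler_pXn2r ?nnegrE ?nrm_ge0.
Qed.

Lemma co_inj x y : (forall i, co x i = co y i) -> x = y.
Proof.
move=> xy; apply/eqP; rewrite -subr_eq0; apply/eqP/nrm0_eq0/eqP.
rewrite eq_le nrm_ge0 andbT; apply: nrm_sqs => // s us.
by rewrite /sqs expr0n big1// => i _; rewrite coB xy subrr ab0 expr0n.
Qed.

Definition cobasis (q : I) : V := xget 0 [set x | co x = fun p => (p == q)%:R].

Lemma cobasisE q p : co (cobasis q) p = (p == q)%:R.
Proof.
rewrite /cobasis; case: xgetP => [x _ ->//|nx]; exfalso.
case: coP => _ _ /(_ (fun p => (p == q)%:R) 1) [s us|x xq]; last exact: nx x xq.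
rewrite /sqs; have [qs|qs] := boolP (q \in s).
  rewrite (bigD1_seq q)//= eqxx ab1 expr1n big1 ?addr0// => i /negbTE ->.
  by rewrite ab0 expr0n.
rewrite big_seq big1// => i si; have -> : (i == q) = false.
  by apply: contraNF qs => /eqP <-.
by rewrite ab0 expr0n.
Qed.

Definition cofin (s : seq I) (xi : I -> C) : V := \sum_(q <- s) xi q *: cobasis q.

Lemma cofinE s xi p : uniq s -> co (cofin s xi) p = if p \in s then xi p else 0.
Proof.
move=> us; rewrite co_sum; have [ps|ps] := boolP (p \in s).
  rewrite (bigD1_seq p)//= coZ cobasisE eqxx mulr1 big1 ?addr0// => q qp.
  by rewrite coZ cobasisE eq_sym (negbTE qp) mulr0.
rewrite big_seq big1// => q qs; rewrite coZ cobasisE.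
by rewrite (_ : (p == q) = false) ?mulr0//; apply: contraNF ps => /eqP ->.
Qed.

Lemma nrm_cofin s xi : uniq s -> nrm (cofin s xi) ^+ 2 = sqs s xi.
Proof.
move=> us; apply/eqP; rewrite eq_le; apply/andP; split; last first.
  apply: (le_trans _ (sqs_nrm (cofin s xi) us)); rewrite /sqs big_seq [leRHS]big_seq.
  by apply: ler_sum => p ps; rewrite cofinE// ps.
rewrite -[leLHS](ger0_norm (sqr_ge0 _)) -lee_fin ger0_norm ?sqr_ge0//.
case: coP => _ <- _; apply: sqsum_le_sqs => t ut; rewrite /sqs.
under eq_bigr do rewrite cofinE//.
rewrite (bigID (mem s))/= [X in _ + X]big1 ?addr0; last first.
  by move=> p /negbTE ->; rewrite ab0 expr0n.
rewrite (eq_bigr (fun p => ab (xi p) ^+ 2)); last by move=> p ->.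
rewrite -big_filter; apply: ler_sum_sub => //; last first.
- by move=> p; rewrite mem_filter => /andP[].
- by rewrite filter_uniq.
- by move=> p; exact: sqr_ge0.
Qed.

(** Once [s0] attains the supremum of the finite square sums up to eps^2, every finite sum disjoint
    from a larger [s] is at most eps^2. *)
Lemma cofin_approx x eps : 0 < eps -> exists s0 : seq I, forall s, uniq s ->
  {subset s0 <= s} -> nrm (x - cofin s (co x)) <= eps.
Proof.
move=> e0; pose A := [set sqs s (co x) | s in [set s : seq I | uniq s]].
have supA : has_sup A.
  split; first by exists (sqs [::] (co x)), [::].
  by exists (nrm x ^+ 2) => _ [s us <-]; exact: sqs_nrm.
have e2 : 0 < eps ^+ 2 by rewrite exprn_gt0.
have [_ [s0 us0 <-] supe] := sup_adherent e2 supA.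
exists s0 => s us ss; apply: nrm_sqs => [|t ut]; first exact: ltW.
have E : sqs t (co (x - cofin s (co x))) =
    \sum_(p <- [seq p <- t | p \notin s]) ab (co x p) ^+ 2.
  rewrite big_filter big_mkcond; apply: eq_bigr => p _; rewrite coB cofinE//.
  by case: ifP => ps /=; rewrite ?subrr ?ab0 ?expr0n// subr0.
set t' := [seq p <- t | p \notin s] in E.
have ust : uniq (s ++ t').
  rewrite cat_uniq us filter_uniq// andbT; apply/hasPn => p.
  by rewrite mem_filter => /andP[].
have le : sqs (s ++ t') (co x) <= sup A.
  by apply: ub_le_sup; [exact: supA.2|exists (s ++ t')].
have le0 : sqs s0 (co x) <= sqs s (co x).
  have := @ler_sum_sub R I (undup s0) s (fun p => ab (co x p) ^+ 2).
  rewrite undup_uniq (undup_id us0); apply => // p; exact: sqr_ge0.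
rewrite E; move: le; rewrite /sqs big_cat/=; move: le0 supe; rewrite /sqs; lra.
Qed.

End coordinate_theory.
End coordinates.
Arguments cobasis {R V I} co q.
Arguments cofin {R V I} co s xi.

(** * Operators and their matrices *)

Section operator_entries.
Context {R : realType}.
Local Notation C := R[i].

Lemma normr_nrm_le {V W : normedModType C} (x : V) (y : W) c :
  (`|x| <= c%:C * `|y|) = (nrm x <= c * nrm y).
Proof. by rewrite (nrmE x) (nrmE y) -rmorphM lecR. Qed.

Lemma nrm_bop {V W : normedModType C} (T : bop V W) x : nrm (T x) <= nrm T * nrm x.
Proof.
by have [_ /(_ x)] := opbound_inf T; rewrite normr_nrm_le.
Qed.

Lemma nrm_bop_le {V W : normedModType C} (T : bop V W) c :
  0 <= c -> (forall x, nrm (T x) <= c * nrm x) -> nrm T <= c.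
Proof.
move=> c0 Tc; apply: op_norm_le; split=> // x.
by rewrite normr_nrm_le.
Qed.

Lemma to_bop_ext {V W : normedModType C} (f : V -> W) (T : bop V W) :
  (forall x, f x = T x) -> to_bop f = T.
Proof. by move=> /funext ->; rewrite /to_bop -[X in insubd _ X]/(val T) valKd. Qed.

Lemma bounded_linear_bop {V W : normedModType C} (f : V -> W) c : linear f ->
  0 <= c -> (forall x, nrm (f x) <= c * nrm x) ->
  exists2 T : bop V W, (forall x, T x = f x) & nrm T <= c.
Proof.
move=> fl c0 fc; have fb : f \in bounded_linear.
  apply/asboolP; split=> //; exists c; split=> // x.
  by rewrite normr_nrm_le.
have E x : to_bop f x = f x by exact: to_bopE.
by exists (to_bop f) => //; apply: nrm_bop_le => // x; rewrite E.
Qed.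

Definition ent {V : normedModType C} {I : choiceType} (co : V -> I -> C)
  (T : bop V V) p q : C := co (T (cobasis co q)) p.

Section theory.
Context {V : normedModType C} {I : choiceType} {co : V -> I -> C}.
Hypothesis coP : coordinates co.
Implicit Types S T : bop V V.

Lemma entD S T p q : ent co (S + T) p q = ent co S p q + ent co T p q.
Proof. exact: (coD coP). Qed.

Lemma entZ a T p q : ent co (a *: T) p q = a * ent co T p q.
Proof. exact: (coZ coP). Qed.

Lemma entZD a S T p q :
  ent co (a *: S + T) p q = a * ent co S p q + ent co T p q.
Proof. by rewrite entD entZ. Qed.

Lemma ent_sumZ J (s : seq J) (c : J -> C) (f : J -> bop V V) p q :
  ent co (\sum_(j <- s) c j *: f j) p q = \sum_(j <- s) c j * ent co (f j) p q.
Proof.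
elim: s => [|j s IH]; first by rewrite !big_nil; exact: (co0 coP).
by rewrite !big_cons entZD IH.
Qed.

Lemma entB S T p q : ent co (S - T) p q = ent co S p q - ent co T p q.
Proof. by rewrite entD -scaleN1r entZ mulN1r. Qed.

Lemma ent0 p q : ent co 0 p q = 0.
Proof. exact: (co0 coP). Qed.

Lemma ent_sum J (s : seq J) (f : J -> bop V V) p q :
  ent co (\sum_(j <- s) f j) p q = \sum_(j <- s) ent co (f j) p q.
Proof. by elim/big_rec2: _ => [|j y x _ <-]; [exact: ent0|rewrite entD]. Qed.

Lemma bop_cofin T t xi p :
  co (T (cofin co t xi)) p = \sum_(q <- t) ent co T p q * xi q.
Proof.
rewrite /cofin linear_sum (co_sum coP); apply: eq_bigr => q _.
by rewrite linearZ (coZ coP) mulrC.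
Qed.

Lemma ent_sums_to T x p : sums_to (fun q => ent co T p q * co x q) (co (T x) p).
Proof.
move=> e e0; have nT : 0 < nrm T + 1 by rewrite ltr_wpDl ?nrm_ge0.
have [s0 H] := cofin_approx coP x (divr_gt0 e0 nT); exists s0 => s us ss.
rewrite -bop_cofin -(coB coP) -linearB; apply: le_trans (ab_co coP _ _) _.
apply: le_trans (nrm_bop _ _) _.
have -> : nrm (cofin co s (co x) - x) = nrm (x - cofin co s (co x)).
  by rewrite /nrm distrC.
apply: (@le_trans _ _ (nrm T * (e / (nrm T + 1)))).
  by rewrite ler_wpM2l ?nrm_ge0 ?H.
by rewrite mulrCA ger_pMr// ler_pdivrMr// mul1r lerDl.
Qed.

Lemma ent_inj S T : (forall p q, ent co S p q = ent co T p q) -> S = T.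
Proof.
move=> ST; apply/val_inj/funext => x; apply: (co_inj coP) => p.
apply: sums_to_unique (ent_sums_to S x p) _.
have -> : (fun q => ent co S p q * co x q) = (fun q => ent co T p q * co x q).
  by apply/funext => q; rewrite ST.
exact: ent_sums_to.
Qed.

Lemma mbound_ent T c : nrm T <= c -> mbound (ent co T) c.
Proof.
move=> Tc; apply: (mbound_le Tc); apply: apply_mbound; first exact: nrm_ge0.
move=> s t xi us ut; rewrite -(nrm_cofin coP _ ut) -exprMn.
under eq_fun do rewrite -bop_cofin.
apply: le_trans (sqs_nrm coP _ us) _.
by rewrite ler_pXn2r ?nnegrE ?mulr_ge0 ?nrm_ge0// nrm_bop.
Qed.

Lemma sums_to_uniform (J : choiceType) (k : I -> J -> C) (v : I -> C) (s : seq I) (d : R) :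
  (forall p, p \in s -> sums_to (k p) (v p)) -> 0 < d ->
  exists t0 : seq J, forall t, uniq t -> {subset t0 <= t} ->
    forall p, p \in s -> ab (\sum_(q <- t) k p q - v p) <= d.
Proof.
elim: s => [|p s IH] kv d0; first by exists [::].
have [p' p's|t0 Ht] := IH _ d0; first by apply: kv; rewrite inE p's orbT.
have [t1 Ht1] := kv p (mem_head _ _) d d0.
exists (t0 ++ t1) => t ut tt p'; rewrite inE => /orP[/eqP ->|p's].
  by apply: Ht1 => // x xt; apply: tt; rewrite mem_cat xt orbT.
by apply: Ht => // x xt; apply: tt; rewrite mem_cat xt.
Qed.

Lemma ab_entB S T p q : ab (ent co S p q - ent co T p q) <= nrm (S - T).
Proof. by rewrite -entB; exact/mbound_entry/mbound_ent. Qed.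

(** A Fatou-type passage to the limit: since [s] is finite, a single finite [t] brings all the row
    sums within d of their limits. *)
Lemma sqs_sums_to_le (J : choiceType) (k : I -> J -> C) (v : I -> C) (s : seq I) (X : R) :
  (forall p, p \in s -> sums_to (k p) (v p)) ->
  (forall t, uniq t -> sqs s (fun p => \sum_(q <- t) k p q) <= X) -> sqs s v <= X.
Proof.
move=> kv kX; apply/ler_addgt0Pr => e e0.
have X0 : 0 <= X by apply: le_trans (kX [::] isT); exact: sqs_ge0.
pose n : R := (size s)%:R; have n0 : 0 <= n by [].
(* Replacing row sums by limits costs at most d X + n (d^2 + d), which for d <= 1 is at most d (X +
   2 n); the extra 1 keeps the denominator positive. *)
pose d := Num.min 1 (e / (X + 2 * n + 1)).
have Xn : 0 < X + 2 * n + 1 by lra.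
have d0 : 0 < d by rewrite lt_min ltr01 divr_gt0.
have d1 : d <= 1 by rewrite ge_min lexx.
have de : d * (X + 2 * n + 1) <= e.
  by rewrite -ler_pdivlMr// ge_min lexx orbT.
have [t ut tv] : exists2 t, uniq t & forall p, p \in s ->
    ab (\sum_(q <- t) k p q - v p) <= d.
  have [t tv] := sums_to_uniform kv d0.
  exists (undup t); first exact: undup_uniq.
  by apply: tv; [exact: undup_uniq|move=> x; rewrite mem_undup].
apply: (@le_trans _ _ ((1 + d) * X + (1 + d^-1) * (n * d ^+ 2))); last first.
  have -> : (1 + d^-1) * (n * d ^+ 2) = n * (d * d + d).
    by field; exact: lt0r_neq0.
  have dd : d * d <= d by rewrite ger_pMr.
  have := ler_wpM2l n0 dd; have : d <= e; first by nra.
  by move=> *; nra.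
apply: le_trans (lerD (ler_wpM2l _ (kX t ut)) (lexx _)); last by lra.
rewrite /n -sum1_size natr_sum mulr_suml mulr_sumr /sqs mulr_sumr.
rewrite -big_split/= big_seq [leRHS]big_seq; apply: ler_sum => p ps.
rewrite mul1r; set u := \sum_(q <- t) _; set x := ab u.
have vd := tv p ps; rewrite -/u in vd.
have vx : ab (v p) <= x + d.
  rewrite -[v p](subKr u) -[u - (u - _)]/(u + - (u - v p)).
  by apply: le_trans (abD _ _) _; rewrite abN lerD2l.
apply: (@le_trans _ _ ((x + d) ^+ 2)).
  by rewrite ler_pXn2r ?nnegrE ?addr_ge0 ?ab_ge0// ltW.
have -> : (1 + d) * x ^+ 2 + (1 + d^-1) * d ^+ 2 = (x + d) ^+ 2 + d * (x - 1) ^+ 2.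
  by field; exact: lt0r_neq0.
by rewrite lerDl mulr_ge0 ?sqr_ge0// ltW.
Qed.

(** Rows are square-summable, so the series for each coordinate of the image converges absolutely;
    the bound on finite sections survives in the limit, and surjectivity of the coordinates supplies
    the image vector. *)
Lemma bop_of_mbound (k : I -> I -> C) c : mbound k c ->
  exists2 T : bop V V, (forall p q, ent co T p q = k p q) & nrm T <= c.
Proof.
move=> kc; have c0 : 0 <= c by case: kc.
(* A row of [k] is the transposed matrix applied to the basis vector at [p]. *)
have row p t : uniq t -> sqs t (k p) <= c ^+ 2.
  move=> ut; have := mbound_apply (fun=> 1) (mbound_tr kc) ut (isT : uniq [:: p]).
  rewrite {2}/sqs big_seq1 ab1 expr1n mulr1.
  by under eq_fun do rewrite big_seq1 mulr1.
have ex x p : exists v, sums_to (fun q => k p q * co x q) v.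
  apply: (@abs_sums_to _ _ _ (c ^+ 2 + nrm x ^+ 2)) => t ut.
  apply: le_trans (lerD (row p t ut) (sqs_nrm coP x ut)).
  rewrite -big_split/=; apply: ler_sum => q _; rewrite abM.
  by have := sqr_ge0 (ab (k p q) - ab (co x q)); have := ab_ge0 (k p q);
    have := ab_ge0 (co x q); nra.
have [v vP] := choice (fun xp : V * I => ex xp.1 xp.2).
have vb x s : uniq s -> sqs s (fun p => v (x, p)) <= (c * nrm x) ^+ 2.
  move=> us; apply: (sqs_sums_to_le (fun p _ => vP (x, p))) => t ut /=.
  apply: le_trans (mbound_apply _ kc us ut) _.
  by rewrite exprMn ler_wpM2l ?sqr_ge0// sqs_nrm.
have [f fP] := choice (fun x => let: And3 _ _ H := coP in H _ _ (vb x)).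
have fl : linear f.
  move=> a x y; apply: (co_inj coP) => p; rewrite (coD coP) (coZ coP) !fP.
  apply: sums_to_unique (vP (_, p)) _ => /=.
  have := sums_toD (sums_toZ a (vP (x, p))) (vP (y, p)).
  congr sums_to; apply/funext => q /=; rewrite (coD coP) (coZ coP); ring.
have fc x : nrm (f x) <= c * nrm x.
  apply: (nrm_sqs coP); first by rewrite mulr_ge0 ?nrm_ge0.
  by move=> s us; rewrite fP vb.
have [T Tf Tc] := bounded_linear_bop fl c0 fc; exists T => // p q.
rewrite /ent Tf fP; apply: sums_to_unique (vP (_, p)) _ => /=.
have := @sums_to_finite _ _ (fun q' => k p q' * co (cobasis co q) q') q.
rewrite cobasisE// eqxx mulr1; apply => i /negbTE iq.
by rewrite cobasisE// iq mulr0.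
Qed.

(** Together with [mbound_ent] this identifies the operator norm with the least matrix bound: the
    operator rebuilt from the entries of [T] is [T], because entries determine operators. *)
Lemma nrm_le_mbound T c : mbound (ent co T) c -> nrm T <= c.
Proof. by move=> /bop_of_mbound[S /ent_inj <-]. Qed.

End theory.
End operator_entries.

(** * Coordinates on Hilbert sums *)

Section nested_coordinates.
Context {R : realType}.
Local Notation C := R[i].
Context {V : normedModType C} {I : choiceType} {co : V -> I -> C}.
Hypothesis coP : coordinates co.

Definition nested_co {J : choiceType} (co : V -> I -> C) (x : ell2 J V) (ji : J * I) : C :=
  co (x ji.1) ji.2.

Lemma sqsum_nested {J : choiceType} (f : J -> V) :
  sqsum ((fun ji : J * I => co (f ji.1) ji.2) : J * I -> C^o) = sqsum f.
Proof.
rewrite /sqsum; transitivity (\esum_(j in [set: J]) \esum_(i in [set: I])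
    (nrm (co (f j) i : C^o) ^+ 2)%:E)%E; last first.
  by apply: eq_esum => j _; case: coP => _ <- _.
rewrite esum_esum; first by congr esum; apply/seteqP; split.
by move=> j i _ _; rewrite lee_fin sqr_ge0.
Qed.

(** The construction iterates: amplified operators on l^2(G, l^2(G)) get the index set 'I_m * (G *
    G). Isometry is Tonelli for nonnegative sums. *)
Lemma coordinates_nested (J : choiceType) :
  coordinates (nested_co (J := J) co).
Proof.
split=> [a x y ji|x|f M fM]; first by rewrite /nested_co -(coZ coP) -(coD coP).
  by rewrite nrm_ell2 -sqsum_nested.
have ex j : exists v, co v = fun i => f (j, i).
  case: coP => _ _ /(_ (fun i => f (j, i)) M); apply => s us.
  rewrite /sqs -(big_map (pair j) xpredT (fun p => ab (f p) ^+ 2)).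
  by apply: fM; rewrite map_inj_uniq// => ? ? [].
have [v vP] := choice ex; have vs : v \in sqsummable.
  apply: (@sqsummableP _ _ _ _ M); rewrite -sqsum_nested.
  apply: sqsum_le_sqs => s us; apply: le_trans (fM s us).
  by rewrite /sqs le_eqVlt; apply/orP; left; apply/eqP/eq_bigr => -[j i] _ /=; rewrite vP.
by exists (to_ell2 v); apply/funext => -[j i]; rewrite /nested_co to_ell2E//= vP.
Qed.

Lemma cobasis_nested {J : choiceType} (j j' : J) q :
  cobasis (nested_co co) (j, q) j' = (j' == j)%:R *: cobasis co q.
Proof.
apply: (co_inj coP) => i.
have := cobasisE (coordinates_nested J) (j, q) (j', i).
rewrite /nested_co /= => ->; rewrite (coZ coP) (cobasisE coP).
by rewrite xpair_eqE; case: eqP => _; rewrite ?mul1r ?mul0r.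
Qed.

End nested_coordinates.

(** * Amplifications of entrywise maps *)

Section amplification.
Context {R : realType}.
Local Notation C := R[i].

Lemma sqsum_ord {V : normedModType C} m (f : 'I_m -> V) :
  sqsum f = (\sum_i nrm (f i) ^+ 2)%:E.
Proof.
rewrite /sqsum esum_fset; last 2 first.
- exact: finite_finset.
- by move=> i _; rewrite lee_fin sqr_ge0.
have -> : [set: 'I_m] = [set` enum 'I_m].
  by apply/seteqP; split=> // i _ /=; rewrite mem_enum.
by rewrite -fsbig_seq ?enum_uniq// sumEFin big_enum.
Qed.

Lemma sqsummable_ord {V : normedModType C} m (f : 'I_m -> V) : f \in sqsummable.
Proof. by apply: (@sqsummableP _ _ _ _ (\sum_i nrm (f i) ^+ 2)); rewrite sqsum_ord. Qed.

Lemma nrm_sum {V : normedModType C} J (s : seq J) (f : J -> V) :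
  nrm (\sum_(j <- s) f j) <= \sum_(j <- s) nrm (f j).
Proof.
elim/big_ind2: _ => [|x a y b xa yb|//]; first by rewrite nrm0.
exact: le_trans (nrmD _ _) (lerD xa yb).
Qed.

Context {V : normedModType C}.

Lemma nrm_ell2_coord {I : choiceType} (x : ell2 I V) i : nrm (x i) <= nrm x.
Proof.
have := le_sqsum x i; rewrite -nrm_ell2 lee_fin.
by rewrite ler_pXn2r ?nnegrE ?nrm_ge0.
Qed.

Lemma ampE m (x : 'M[bop V V]_m) xi i : amp x xi i = \sum_j x i j (xi j).
Proof.
pose f (xi : ell2 'I_m V) : ell2 'I_m V := to_ell2 (fun i => \sum_j x i j (xi j)).
have fE z k : f z k = \sum_j x k j (z j) by rewrite to_ell2E ?sqsummable_ord.
have fl : linear f.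
  move=> a y z; apply/val_inj/funext => k.
  rewrite [LHS]fE [RHS](_ : _ = a *: f y k + f z k)// !fE scaler_sumr -big_split/=.
  by apply: eq_bigr => j _; rewrite -linearZ -linearD.
(* A crude bound suffices: its only purpose is to show that [to_bop] in [amp] does not return its
   default 0. *)
pose c := Num.sqrt (\sum_i (\sum_j nrm (x i j)) ^+ 2).
have c0 : 0 <= c by exact: sqrtr_ge0.
have fc z : nrm (f z) <= c * nrm z.
  rewrite -(@ler_pXn2r _ 2) ?nnegrE ?mulr_ge0 ?nrm_ge0// exprMn.
  rewrite [c ^+ 2]sqr_sqrtr ?sumr_ge0// => [|k _]; last exact: sqr_ge0.
  rewrite -lee_fin nrm_ell2 sqsum_ord lee_fin mulr_suml; apply: ler_sum => k _.
  rewrite -exprMn ler_pXn2r ?nnegrE ?nrm_ge0 ?mulr_ge0 ?nrm_ge0 ?sumr_ge0//; last first.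
    by move=> j _; exact: nrm_ge0.
  rewrite fE; apply: le_trans (nrm_sum _ _) _; rewrite mulr_suml.
  apply: ler_sum => j _; apply: le_trans (nrm_bop _ _) _.
  by rewrite ler_wpM2l ?nrm_ge0// nrm_ell2_coord.
have [T Tf _] := bounded_linear_bop fl c0 fc.
by rewrite /amp -/f (@to_bop_ext _ _ _ f T) ?Tf.
Qed.

Context {I : choiceType} {co : V -> I -> C}.
Hypothesis coP : coordinates co.

Lemma ent_amp m (x : 'M[bop V V]_m) (ip jq : 'I_m * I) :
  ent (nested_co co) (amp x) ip jq = ent co (x ip.1 jq.1) ip.2 jq.2.
Proof.
case: ip jq => i p [j q] /=; rewrite /ent {1}/nested_co /= ampE (co_sum coP).
rewrite (bigD1 j)//= big1 ?addr0 => [|k kj].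
  by rewrite (cobasis_nested coP) eqxx scale1r.
by rewrite (cobasis_nested coP) (negbTE kj) scale0r linear0 (co0 coP).
Qed.

Lemma ampB m (x y : 'M[bop V V]_m) : amp x - amp y = amp (x - y).
Proof.
apply: (ent_inj (coordinates_nested coP 'I_m)) => ip jq.
apply: (etrans (entB (coordinates_nested coP 'I_m) _ _ _ _)).
apply: (etrans _ (esym (ent_amp (x - y) ip jq))); rewrite !mxE (entB coP).
by congr (_ - _); exact: ent_amp.
Qed.

Context {G : choiceType} (sigma tau : I -> G).

(** In the coordinates (i, p) of the amplification the weight does not see i, so the amplified map
    is the inflation of [chi] along (i, p) |-> [sigma p] and (j, q) |-> [tau q]; hence [M] does not
    depend on [m]. *)
Lemma amp_schur_le chi M m (x y : 'M[bop V V]_m) : schurb chi M ->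
  (forall i j p q, ent co (y i j) p q = chi (sigma p) (tau q) * ent co (x i j) p q) ->
  nrm (amp y) <= M * nrm (amp x).
Proof.
move=> chiM yx; apply: (nrm_le_mbound (coordinates_nested coP 'I_m)).
have := mbound_ent (coordinates_nested coP 'I_m) (lexx (nrm (amp x))).
move=> /(schurb_inflate (fun ip => sigma ip.2) (fun jq => tau jq.2) chiM).
apply: eq_mbound => ip jq; apply: (etrans _ (esym (ent_amp y ip jq))).
by rewrite yx; congr (_ * _); exact: ent_amp.
Qed.

Lemma schur_exists chi M (T : bop V V) : schurb chi M -> exists2 S : bop V V,
  (forall p q, ent co S p q = chi (sigma p) (tau q) * ent co T p q) &
  nrm S <= M * nrm T.
Proof.
move=> chiM; apply: (bop_of_mbound coP).
exact: (schurb_inflate sigma tau chiM (mbound_ent coP (lexx (nrm T)))).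
Qed.

End amplification.

(** Compression by coordinate projections: the indicator is absorbed into the test vectors, whose
    square sums can only decrease. *)
Lemma mbound_restrict {R : realType} {I J : choiceType} (k : I -> J -> R[i]) c
    (A : pred I) (B : pred J) : mbound k c ->
  mbound (fun p q => (A p && B q)%:R * k p q) c.
Proof.
move=> [c0 kc]; split=> // s t eta xi us ut.
have le (K : Type) (P : pred K) (u : seq K) (z : K -> R[i]) :
    sqs u (fun x => (P x)%:R * z x) <= sqs u z.
  apply: ler_sum => x _; rewrite abM; case: (P x); first by rewrite ab1 mul1r.
  by rewrite ab0 mul0r expr0n sqr_ge0.
apply: le_trans (ler_wpM2l c0 (lerD (le _ A s eta) (le _ B t xi))).
apply: (le_trans _ (kc _ _ _ _ us ut)); rewrite le_eqVlt; apply/orP; left.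
apply/eqP; congr (_ * ab _); apply: eq_bigr => p _; apply: eq_bigr => q _.
by rewrite -mulnb natrM; ring.
Qed.

(** * Compactness of finite-rank operators *)

Section finite_rank.
Context {R : realType}.
Local Notation C := R[i].

Lemma continuous_real_complex : continuous (fun a : R => a%:C : C^o).
Proof.
move=> a; apply/cvgrPdist_lt => -[e e'] /=; rewrite ltcE /= => /andP[/eqP -> e0].
near=> x; rewrite -rmorphB [`| _ |](_ : _ = (`|a - x|)%:C); last first.
  by rewrite normc_def /= expr0n addr0 sqrtr_sqr.
rewrite ltcR; near: x; exact: cvgr_dist_lt.
Unshelve. all: by end_near. Qed.

(** Scalars of modulus at most [M] lie in the square [-M, M]^2, whose compactness is carried over by
    the continuous map (x, y) |-> (x + i y) v. *)
Lemma compact_box {V : normedModType C} (M : R) (v : V) :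
  exists2 K : set V, compact K & forall z, ab z <= M -> K (z *: v).
Proof.
pose f (x : R * R) : V := (x.1%:C + 'i%C * x.2%:C : C^o) *: v.
exists (f @` (`[- M, M] `*` `[- M, M])).
  apply: continuous_compact; last by apply: compact_setX; exact: segment_compact.
  apply: continuous_subspaceT => x; apply: cvgZr_tmp; apply: cvgD.
    apply: (cvg_comp (@fst R R) (fun a => a%:C)); first exact: cvg_fst.
    exact: continuous_real_complex.
  apply: cvgM; first exact: cvg_cst.
  apply: (cvg_comp (@snd R R) (fun a => a%:C)); first exact: cvg_snd.
  exact: continuous_real_complex.
move=> z zM; exists (complex.Re z, complex.Im z); last by rewrite /f /= -complexE.
have {zM} : complex.Re z ^+ 2 + complex.Im z ^+ 2 <= M ^+ 2 /\ 0 <= M.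
  have M0 := le_trans (ab_ge0 z) zM; split=> //; move: zM; rewrite abE.
  case: z => a b /=; rewrite -(@ler_pXn2r _ 2) ?nnegrE ?sqrtr_ge0//.
  by rewrite sqr_sqrtr// addr_ge0 ?sqr_ge0.
move: (complex.Re z) (complex.Im z) => a b [abM M0].
by split; rewrite /= in_itv /=; apply/andP; split; nra.
Qed.

Context {V : normedModType C} {I : choiceType} {co : V -> I -> C}.
Hypothesis coP : coordinates co.

Lemma compact_cofin (M : R) (s : seq I) : exists2 K : set V, compact K &
  forall xi, (forall q, ab (xi q) <= M) -> K (cofin co s xi).
Proof.
elim: s => [|q s [K Kc KM]].
  by exists [set 0]; [exact: compact_set1|move=> xi _; rewrite /cofin big_nil].
have [L Lc LM] := compact_box M (cobasis co q).
exists ((fun x : V * V => x.1 + x.2) @` (L `*` K)).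
  apply: continuous_compact (compact_setX Lc Kc).
  by apply: continuous_subspaceT => x; exact: add_continuous.
move=> xi xiM; exists (xi q *: cobasis co q, cofin co s xi).
  by split; [exact: LM|exact: KM].
by rewrite /cofin big_cons.
Qed.

(** With only finitely many nonzero rows, the image of the unit ball lies among the combinations of
    finitely many basis vectors with coefficients bounded by [nrm T]. *)
Lemma finitely_supported_compact (T : bop V V) (s : seq I) :
  (forall p q, p \notin s -> ent co T p q = 0) -> compact_on setT T.
Proof.
move=> Ts; have Tp x p : p \notin s -> co (T x) p = 0.
  move=> ps; apply: sums_to_unique (ent_sums_to coP T x p) _ => e e0.
  exists [::] => t ut _; rewrite big1 ?subrr ?ab0 ?ltW// => q _.
  by rewrite Ts// mul0r.
have [K Kc KM] := compact_cofin (nrm T) (undup s).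
apply: (precompact_subset _ (compact_precompact (@norm_hausdorff _ _) Kc)).
move=> _ [x [_ x1] <-]; have -> : T x = cofin co (undup s) (co (T x)).
  apply: (co_inj coP) => p; rewrite (cofinE coP) ?undup_uniq// mem_undup.
  by case: ifPn => // /Tp.
apply: KM => q; apply: le_trans (ab_co coP _ _) _; apply: le_trans (nrm_bop _ _) _.
by rewrite ler_piMr ?nrm_ge0// -lecR -nrmE.
Qed.

End finite_rank.

(** * Compact Schur multipliers on l^2(G) and their truncation *)

Section schur_multipliers.
Context {R : realType} {G : choiceType}.
Local Notation C := R[i].
Local Notation H := (ell2 G C^o).

Definition ell2_co (x : H) (i : G) : C := x i.
Let coP : coordinates ell2_co := @coordinates_ell2 R G.

Lemma cobasis_ell2 q : cobasis ell2_co q = Defs.basis q.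
Proof.
by apply: (co_inj coP) => p; rewrite (cobasisE coP) /ell2_co basisE.
Qed.

Lemma entryE (T : bop H H) p q : entry T p q = ent ell2_co T p q.
Proof. by rewrite /ent cobasis_ell2. Qed.

Lemma schur_mapE (phi : G -> G -> C) (T : bop H H) p q : schur_multiplier phi ->
  ent ell2_co (schur_map phi T) p q = phi q p * ent ell2_co T p q.
Proof.
case=> ex _; rewrite -!entryE.
exact: (xgetPex 0 (ex T) : schur_rel phi T (schur_map phi T)).
Qed.

Lemma schur_multiplier_schurb (phi : G -> G -> C) : schur_multiplier phi ->
  exists M, schurb (fun p q => phi q p) M.
Proof.
move=> schur; have [_ [_ _ [c cP]]] := schur.
(* A constant in [cb_bound] carries no sign, whereas [schurb] asks for a nonnegative one. The
   complete bound is read at [m = 1], where the index pairs are in bijection with [G]. *)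
exists (Num.max c 0); split=> [|k d kd]; first by rewrite le_max lexx orbT.
have [T Tk _] := bop_of_mbound coP kd; have d0 : 0 <= d by case: kd.
have ampP := coordinates_nested coP 'I_1.
pose x : 'M[bop H H]_1 := const_mx T.
have xd : nrm (amp x) <= d.
  apply: (nrm_le_mbound ampP).
  have inj1 : injective (fun ip : 'I_1 * G => ip.2).
    by move=> [i p] [j q] /= ->; rewrite (ord1 i) (ord1 j).
  apply: eq_mbound (mbound_inj inj1 inj1 kd) => ip jq.
  by rewrite (ent_amp coP x) mxE Tk.
have : nrm (amp (map_mx (schur_map phi) x)) <= Num.max c 0 * d.
  apply: (@le_trans _ _ (c * nrm (amp x))).
    by rewrite -normr_nrm_le; exact: (cP 1 x (fun _ _ => I)).
  apply: (@le_trans _ _ (Num.max c 0 * nrm (amp x))).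
    by rewrite ler_wpM2r ?nrm_ge0// le_max lexx.
  by rewrite ler_wpM2l// le_max lexx orbT.
have pinj : injective (pair (ord0 : 'I_1) : G -> 'I_1 * G) by move=> ? ? [].
move=> /(mbound_ent ampP)/(mbound_inj pinj pinj); apply: eq_mbound => p q.
by rewrite (ent_amp coP (map_mx _ x)) !mxE /= schur_mapE// Tk.
Qed.

Definition finitely_supported_ball : set (bop H H) :=
  [set T | nrm T <= 1 /\ exists s : seq G,
    forall p q, ~~ ((p \in s) && (q \in s)) -> ent ell2_co T p q = 0].

(* The centres are taken inside the set, hence finitely supported. *)
Lemma schur_totally_bounded (phi : G -> G -> C) (eps : R) :
  compact_schur_multiplier phi -> 0 < eps ->
  exists2 X : seq (bop H H), {in X, forall T, finitely_supported_ball T} &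
    forall T, finitely_supported_ball T ->
      exists2 S, S \in X & nrm (schur_map phi T - schur_map phi S) <= eps.
Proof.
move=> [_ cphi] e0; set A := schur_map phi @` finitely_supported_ball.
have : precompact A.
  apply: precompact_subset cphi => _ [T [T1 [s Ts]] <-]; exists T => //; split.
    apply: (finitely_supported_compact coP (s := s)) => p q ps.
    by apply: Ts; rewrite (negbTE ps).
  by rewrite /= nrmE lecR.
rewrite precompactE compact_cover cover_compactE.
pose U (T : bop H H) := [set y : bop H H | nrm (y - schur_map phi T) < eps].
have Uo T : open (U T).
  rewrite (_ : U T = ball (schur_map phi T) eps%:C).
    by apply: ball_open; rewrite ltcR.
  by rewrite -ball_normE; apply/seteqP; split=> y; rewrite /= distrC nrmE ltcR.
have eC : (0 : C) < eps%:C by rewrite ltcR.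
move=> /(_ _ finitely_supported_ball (fun T => closure A `&` U T)) [].
- by exists U.
- move=> y Ay; have [_ [[T FT <-] /=]] := Ay _ (nbhsx_ballx y _ eC).
  rewrite -ball_normE /= nrmE ltcR => yT.
  by exists T.
move=> D DF AD; exists (finmap.enum_fset D) => [T TD|T FT].
  by have := DF T TD; rewrite inE.
have [|S SD [_ /ltW US]] := AD (schur_map phi T); last by exists S.
by apply: subset_closure; exists T.
Qed.

(** Here [s] gathers the supports of the centres of an eps/2-net of the images of finitely supported
    contractions. An arbitrary bounded matrix is brought into that ball by restricting it to a
    finite rectangle and rescaling. *)
Lemma compact_schur_truncation (phi : G -> G -> C) (eps : R) :
  compact_schur_multiplier phi -> 0 < eps ->
  exists2 s : seq G, uniq s &
    schurb (fun p q => (1 - ((p \in s) && (q \in s))%:R) * phi q p) eps.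
Proof.
move=> cphi e0; have e2 : 0 < eps / 2 by rewrite divr_gt0.
have schur := cphi.1.
have [X XF Xe] := schur_totally_bounded cphi e2.
have ex T : exists s : seq G, T \in X -> forall p q,
    ~~ ((p \in s) && (q \in s)) -> ent ell2_co T p q = 0.
  have [/XF[_ [s sT]]|] := boolP (T \in X); first by exists s.
  by exists [::].
have [f fP] := choice ex.
pose s := undup (flatten (map f X)); exists s; first exact: undup_uniq.
have sX T p q : T \in X -> ~~ ((p \in s) && (q \in s)) -> ent ell2_co T p q = 0.
  move=> TX pq; apply: fP => //; apply: contra pq => /andP[pf qf]; rewrite !mem_undup.
  by apply/andP; split; apply/flattenP; exists (f T) => //; exact: map_f.
pose chi p q := (1 - ((p \in s) && (q \in s))%:R) * phi q p.
have unit_ball T : finitely_supported_ball T ->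
    mbound (fun p q => chi p q * ent ell2_co T p q) eps.
  (* S_phi(S) is supported in s x s, so removing the s x s corner from S_phi(T)
     amounts to removing it from the small operator S_phi(T) - S_phi(S). *)
  move=> /Xe[S SX /(mbound_ent coP) w]; rewrite [eps]splitr.
  have := mboundD w (mboundZ (-1) (mbound_restrict (mem s) (mem s) w)).
  rewrite abN ab1 mul1r; apply: eq_mbound => p q.
  rewrite (entB coP) !schur_mapE// /chi /=.
  case: (boolP ((p \in s) && (q \in s))) => pq.
    by rewrite /= mul1r mulN1r !subrr !mul0r.
  by rewrite (sX S)// mulr0 !subr0 mul0r mulr0 addr0 mul1r.
split=> [|k d kd]; first exact: ltW.
have d0 : 0 <= d by case: kd.
have [dz|dn] := eqVneq d 0.
  rewrite dz in kd *; rewrite mulr0; apply: (eq_mbound _ kd) => p q.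
  have kpq := mbound_entry p q kd; have k0 : k p q = 0.
    by apply/ab_eq0/eqP; rewrite eq_le ab_ge0 andbT.
  by rewrite k0 mulr0.
have dp : 0 < d by rewrite lt_neqAle eq_sym dn.
apply: mbound_local => [|u v uu uv]; first by rewrite mulr_ge0// ltW.
(* The finite section of [k], scaled to bound 1; multiplying by d afterwards restores the entries on
   the rectangle. The case d = 0 was separated because there [k] itself vanishes. *)
pose k' p q := (d^-1)%:C * (((p \in u) && (q \in v))%:R * k p q).
have k'1 : mbound k' 1.
  have := mboundZ (d^-1)%:C (mbound_restrict (mem u) (mem v) kd).
  by rewrite abR ?invr_ge0// mulVf.
have [T Tk T1] := bop_of_mbound coP k'1.
have FT : finitely_supported_ball T.
  split=> //; exists (u ++ v) => p q; rewrite Tk /k' !mem_cat => pq.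
  case: (boolP ((p \in u) && (q \in v))) => [/andP[pu qv]|_]; last by rewrite mul0r mulr0.
  by rewrite pu qv orbT in pq.
exists (fun p q => d%:C * (chi p q * ent ell2_co T p q)).
  by have := mboundZ d%:C (unit_ball T FT); rewrite abR// mulrC.
move=> p q pu qv; rewrite Tk /k' pu qv mul1r mulrCA [X in _ = _ * X]mulrA.
by rewrite -rmorphM mulfV// mul1r.
Qed.

End schur_multipliers.

Lemma bopZD {R : realType} {V W : normedModType R[i]} a (S T : bop V W) x :
  (a *: S + T) x = a *: S x + T x.
Proof. by []. Qed.

Lemma bop_ext {R : realType} {V W : normedModType R[i]} (S T : bop V W) :
  (forall x, S x = T x) -> S = T.
Proof. by move=> ST; apply/val_inj/funext. Qed.

(** * Weighted composition operators *)

Section weighted_composition.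
Context {R : realType} {V : normedModType R[i]} {I : choiceType} {co : V -> I -> R[i]}.
Hypothesis coP : coordinates co.

(** Translations, pi(a) and pi(a) lambda_t all have this form. Producing an operator with the
    expected coordinates shows that [to_bop] and [to_ell2] in their definitions do not collapse to
    0. *)
Lemma weighted_composition (w : I -> R[i]) (g : I -> I) (M : R) :
  injective g -> 0 <= M -> (forall p, ab (w p) <= M) ->
  exists2 T : bop V V, (forall x p, co (T x) p = w p * co x (g p)) & nrm T <= M.
Proof.
move=> gI M0 wM.
have wb x s : uniq s -> sqs s (fun p => w p * co x (g p)) <= (M * nrm x) ^+ 2.
  move=> us; have ug : uniq (map g s) by rewrite map_inj_uniq.
  rewrite exprMn; apply: (le_trans _ (ler_wpM2l (sqr_ge0 M) (sqs_nrm coP x ug))).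
  rewrite /sqs big_map mulr_sumr; apply: ler_sum => p _; rewrite abM exprMn.
  by rewrite ler_wpM2r ?sqr_ge0// ler_pXn2r ?nnegrE ?ab_ge0.
have [f fP] := choice (fun x => let: And3 _ _ H := coP in H _ _ (wb x)).
have [||x|T Tf TM] := @bounded_linear_bop R V V f M; last first.
- by exists T => // x p; rewrite Tf fP.
- by apply: (nrm_sqs coP) => [|s us]; [rewrite mulr_ge0 ?nrm_ge0|rewrite fP wb].
- exact: M0.
move=> a x y; apply: (co_inj coP) => p; rewrite (coD coP) (coZ coP) !fP.
by rewrite (coD coP) (coZ coP); ring.
Qed.

End weighted_composition.

(** * Multiplication operators by functions vanishing at infinity *)

Section multiplication_operators.
Context {R : realType} {G : choiceType}.
Local Notation C := R[i].
Local Notation H := (ell2 G C^o).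

Definition diagonal (T : bop H H) (s : G) : C := entry T s s.

Lemma entry_mulop (a : G -> C) p q : c0 a -> entry (mulop a) p q = (p == q)%:R * a p.
Proof. by move=> a0; rewrite /entry mulopE// basisE mulrC. Qed.

Lemma diagonal_mulop (a : G -> C) : c0 a -> diagonal (mulop a) = a.
Proof.
by move=> a0; apply/funext => s; rewrite /diagonal entry_mulop// eqxx mul1r.
Qed.

Lemma c0_diagonal (T : bop H H) : c0_ops T -> c0 (diagonal T).
Proof. by move=> [a a0 <-]; rewrite diagonal_mulop. Qed.

Lemma mulop_diagonal (T : bop H H) : c0_ops T -> mulop (diagonal T) = T.
Proof. by move=> [a a0 <-]; rewrite diagonal_mulop. Qed.

Lemma entry_c0_ops (T : bop H H) p q : c0_ops T ->
  entry T p q = (p == q)%:R * diagonal T p.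
Proof. by move=> [a a0 <-]; rewrite diagonal_mulop// entry_mulop. Qed.

Lemma ab_diagonal (T : bop H H) s : ab (diagonal T s) <= nrm T.
Proof.
rewrite /diagonal entryE.
exact: (mbound_entry s s (mbound_ent coordinates_ell2 (lexx (nrm T)))).
Qed.

(** The level set of h a at e lies in the level set of a at e / max(M, 1); the maximum keeps the
    divisor positive. *)
Lemma c0_mul (h a : G -> C) (M : R) : (forall s, ab (h s) <= M) -> c0 a ->
  c0 (fun s => h s * a s).
Proof.
move=> hM a0 e e0; have N0 : 0 < Num.max M 1 by rewrite lt_max ltr01 orbT.
apply: sub_finite_set (a0 (e / Num.max M 1) (divr_gt0 e0 N0)) => s /=.
rewrite !normr_ab !lecR abM ler_pdivrMr// => /le_trans; apply.
by rewrite mulrC ler_wpM2l ?ab_ge0// le_max hM.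
Qed.

Lemma c0_cst0 : c0 (fun _ : G => 0 : C).
Proof.
move=> e e0; rewrite (_ : [set _ | _] = set0)//.
by apply/seteqP; split=> // s /=; rewrite normr0 lecR leNgt e0.
Qed.

Lemma c0_comp (g : G -> G) (a : G -> C) : injective g -> c0 a -> c0 (a \o g).
Proof.
move=> gI a0 e e0; have := finite_preimage (f := g) _ (a0 e e0).
by apply; exact: in2W.
Qed.

Lemma c0_ops0 : c0_ops (0 : bop H H).
Proof.
exists (fun=> 0); first exact: c0_cst0.
apply: bop_ext => x; apply: (co_inj coordinates_ell2) => s.
by rewrite mulopE ?mul0r//; exact: c0_cst0.
Qed.

Lemma c0_opsZD c (S T : bop H H) : c0_ops S -> c0_ops T -> c0_ops (c *: S + T).
Proof.
move=> [a a0 <-] [b b0 <-]; have ab0 : c0 (fun s => c * a s + b s).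
  move=> e e0; have e2 : 0 < e / 2 by rewrite divr_gt0.
  have ca := c0_mul (h := fun=> c) (fun=> lexx (ab c)) a0.
  have := ca _ e2; have := b0 _ e2; rewrite -[X in _ -> X -> _]/(finite_set _).
  move=> fb fa; apply: sub_finite_set (_ : finite_set (_ `|` _)).
    2: by rewrite finite_setU; split; [exact: fa|exact: fb].
  move=> s /=; rewrite !normr_ab !lecR => le.
  have := le_trans le (abD _ _); case: (leP (e / 2) (ab (c * a s))); first by left.
  by move=> h1 h2; right; lra.
exists (fun s => c * a s + b s) => //.
apply: bop_ext => x; apply: (co_inj coordinates_ell2) => s.
rewrite bopZD (coD coordinates_ell2) (coZ coordinates_ell2).
have Ea : ell2_co (mulop a x) s = a s * x s := mulopE x s a0.
have Eb : ell2_co (mulop b x) s = b s * x s := mulopE x s b0.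
apply: (etrans (mulopE x s ab0)).
apply: (etrans _ (esym (congr2 (fun u v => c * u + v) Ea Eb))).
by rewrite mulrDl mulrA.
Qed.

End multiplication_operators.

(** * Matrices of the elements pi~(f) *)

Section crossed_product_entries.
Context {R : realType} {G : groupType}.
Local Notation C := R[i].
Local Notation H := (ell2 G C^o).
Local Notation HG := (ell2 G H).

Definition crossed_co : HG -> G * G -> C := nested_co ell2_co.
Let coP : coordinates (crossed_co) := coordinates_nested coordinates_ell2 G.

Lemma to_ell2_ext {I : choiceType} {V : normedModType C} (f : I -> V) (x : ell2 I V) :
  (forall i, f i = x i) -> to_ell2 f = x.
Proof. by move=> /funext ->; rewrite /to_ell2 -[X in insubd _ X]/(val x) valKd. Qed.

Lemma c0_actionE (a : G -> C) (s : G) (x : H) r : c0 a ->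
  c0_action (s^-1)%g (mulop a) x r = a (s * r)%g * x r.
Proof.
move=> a0; rewrite /c0_action mulop_liftE// mulopE; first by rewrite invgK.
by apply: (c0_comp _ a0); exact: mulgI.
Qed.

Lemma translationE t (x : HG) s r :
  translation t x s r = x (t^-1 * s)%g r.
Proof.
have gI : injective (fun sr : G * G => ((t^-1 * sr.1)%g, sr.2)).
  by move=> [s1 r1] [s2 r2] /= [/mulgI -> ->].
have [T TE _] := weighted_composition (w := fun=> 1) coP gI ler01
  (fun=> eq_ind_r (fun z => z <= 1) (lexx 1) ab1).
rewrite /translation (_ : to_bop _ = T).
  by apply: (etrans (TE x (s, r))); rewrite mul1r.
apply: to_bop_ext => y; apply: to_ell2_ext => s'; apply: (co_inj coordinates_ell2) => r'.
by apply: esym; apply: (etrans (TE y (s', r'))); rewrite mul1r.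
Qed.

Lemma cov_repE (a : G -> C) (x : HG) s r : c0 a ->
  cov_rep c0_action (mulop a) x s r = a (s * r)%g * x s r.
Proof.
move=> a0; have aM p : ab (a (p.1 * p.2)%g) <= nrm (mulop a).
  by rewrite -{1}(diagonal_mulop a0) ab_diagonal.
have [T TE _] := weighted_composition coP (@inj_id (G * G)%type) (nrm_ge0 _) aM.
rewrite /cov_rep (_ : to_bop _ = T); first by rewrite [LHS](TE x (s, r)).
apply: to_bop_ext => y; apply: to_ell2_ext => s'; apply: (co_inj coordinates_ell2) => r'.
by rewrite [LHS]c0_actionE// [RHS](TE y (s', r')).
Qed.

Definition covariant_term (A : bop H H) (t : G) : bop HG HG :=
  to_bop (cov_rep c0_action A \o translation t).

Lemma covariant_termP (A : bop H H) t : c0_ops A ->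
  nrm (covariant_term A t) <= nrm A /\ forall (x : HG) s r,
    covariant_term A t x s r = diagonal A (s * r)%g * x (t^-1 * s)%g r.
Proof.
move=> cA; have aM p : ab (diagonal A (p.1 * p.2)%g) <= nrm A by exact: ab_diagonal.
have gI : injective (fun sr : G * G => ((t^-1 * sr.1)%g, sr.2)).
  by move=> [s1 r1] [s2 r2] /= [/mulgI -> ->].
have [T TE TA] := weighted_composition coP gI (nrm_ge0 _) aM.
have -> : covariant_term A t = T.
  apply: to_bop_ext => x; apply: (co_inj coP) => -[s r].
  rewrite (TE x (s, r)) -{1}(mulop_diagonal cA).
  apply: (etrans (cov_repE _ _ _ (c0_diagonal cA))).
  by congr (_ * _); exact: translationE.
by split=> // x s r; exact: (TE x (s, r)).
Qed.

Lemma ent_covariant_term (A : bop H H) t s r s' r' : c0_ops A ->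
  ent crossed_co (covariant_term A t) (s, r) (s', r') =
  ((t^-1 * s == s')%g && (r == r'))%:R * diagonal A (s * r)%g.
Proof.
move=> cA; have [_ E] := covariant_termP t cA; rewrite /ent.
apply: (etrans (E _ _ _)); rewrite mulrC; congr (_ * _).
exact: (cobasisE coP (s', r') ((t^-1 * s)%g, r)).
Qed.

(* The matrix of integrated f on l^2(G x G). *)
Definition crossed_kernel (f : G -> bop H H) (p q : G * G) : C :=
  (p.2 == q.2)%:R * diagonal (f (p.1 * q.1^-1)%g) (p.1 * p.2)%g.

(** At the position ((s, r), (s', r')) the only t that can contribute is s s'^-1, so a partial sum
    is the kernel cut down to the positions whose t has been reached. *)
Lemma ent_sum_covariant (f : G -> bop H H) (u : seq G) p q : uniq u ->
  (forall t, c0_ops (f t)) ->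
  \sum_(t <- u) ent crossed_co (covariant_term (f t) t) p q =
  (p.1 * q.1^-1 \in u)%g%:R * crossed_kernel f p q.
Proof.
case: p q => s r [s' r'] uu cf /=; under eq_bigr do rewrite ent_covariant_term//.
have E t : (t^-1 * s == s')%g = (t == s * s'^-1)%g.
  by apply/eqP/eqP => [<-|->]; rewrite invgM invgK ?mulVKg ?mulgVK.
have E' t : ((t^-1 * s == s')%g && (r == r'))%:R * diagonal (f t) (s * r)%g =
    (t == s * s'^-1)%g%:R * crossed_kernel f (s, r) (s', r').
  rewrite E /crossed_kernel /= -mulnb natrM -mulrA.
  by case: eqP => [->|]; rewrite ?mul0r.
under eq_bigr do rewrite E'; rewrite -mulr_suml; congr (_ * _).
have [tu|tu] := boolP (s * s'^-1 \in u)%g.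
  rewrite (bigD1_seq _ tu)//= eqxx big1 ?addr0// => t /negbTE ->.
  by [].
rewrite big_seq big1// => t tu'; rewrite (_ : (t == _) = false)//.
by apply: contraNF tu => /eqP <-.
Qed.

(** A finite rectangle meets finitely many t, so there the kernel is a finite sum of matrices of
    pi(f(t)) lambda_t, each bounded by [nrm (f t)]. *)
Lemma crossed_kernel_mbound (f : G -> bop H H) c : 0 <= c ->
  (forall t, c0_ops (f t)) ->
  (forall u, uniq u -> \sum_(t <- u) nrm (f t) <= c) ->
  mbound (crossed_kernel f) c.
Proof.
move=> c0 cf fc; apply: mbound_local => // S T _ _.
pose u := undup [seq (p.1 * q.1^-1)%g | p <- S, q <- T].
exists (fun p q => \sum_(t <- u) ent crossed_co (covariant_term (f t) t) p q).
  apply: mbound_le (fc u (undup_uniq _)) _; apply: mbound_sum => t.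
  by apply: (mbound_ent coP); have [] := covariant_termP t (cf t).
move=> p q pS qT; rewrite ent_sum_covariant ?undup_uniq//.
by rewrite mem_undup (allpairs_f (fun p q => (p.1 * q.1^-1)%g) pS qT) mul1r.
Qed.

Lemma l1P (f : G -> bop H H) : l1 c0_ops f <->
  (forall t, c0_ops (f t)) /\
  exists N, forall u, uniq u -> \sum_(t <- u) nrm (f t) <= N.
Proof.
have E : (fun t => `|(nrm (f t))%:E|%E) = (fun t => (nrm (f t))%:E).
  by apply/funext => t; rewrite /= ger0_norm ?nrm_ge0.
rewrite /l1 /= /summable E; split=> -[cf fN]; split=> //.
  have fin : (\esum_(t in [set: G]) (nrm (f t))%:E)%E \is a fin_num.
    by rewrite ge0_fin_numE// esum_ge0// => t _; rewrite lee_fin nrm_ge0.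
  exists (fine (\esum_(t in [set: G]) (nrm (f t))%:E)%E) => u uu.
  by rewrite -lee_fin fineK// le_esum_seq.
by case: fN => N fN; apply: le_lt_trans (esum_le_seq fN) _; exact: ltry.
Qed.

(** The kernel is the matrix of some operator T, and the partial sums converge to T in norm because
    the remainder is the kernel of a tail of [f], controlled by its l^1 norm. *)
Lemma ent_integrated (f : G -> bop H H) p q : l1 c0_ops f ->
  ent crossed_co (integrated c0_action f) p q = crossed_kernel f p q.
Proof.
move=> /l1P[cf [N fN]].
have N0 : 0 <= N by have := fN [::] isT; rewrite big_nil.
have [T Tf _] := bop_of_mbound coP (crossed_kernel_mbound N0 cf fN).
suff -> : integrated c0_action f = T by exact: Tf.
have FF := @summability.totally_filter G.
apply: cvg_lim; first exact: norm_hausdorff.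
apply/cvgrPdist_le => -[e e'] /=; rewrite ltcE /= => /andP[/eqP -> e0].
pose A := [set \sum_(t <- u) nrm (f t) | u in [set u : seq G | uniq u]].
have supA : has_sup A.
  by split; [exists (\sum_(t <- [::]) nrm (f t)), [::]|exists N => _ [s us <-]; exact: fN].
have [_ [s0 us0 <-] supe] := sup_adherent e0 supA.
exists (finmap.seq_fset tt s0) => // B /= /finmap.fsubsetP sB.
rewrite (nrmE (_ - _)) lecR; apply: (nrm_le_mbound coP).
have ubs := finmap.fset_uniq B; pose bs : seq G := finmap.enum_fset B.
have sbs : {subset s0 <= bs}.
  move=> t ts; apply: sB.
  exact: (etrans (finmap.seq_fsetE tt s0 t) ts).
(* The tail of [f] outside the finite set B. Its finite sums are at most e, since B contains a set
   on which the sum of norms is within e of the supremum. *)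
pose g t := if t \in bs then 0 else f t.
have cg t : c0_ops (g t) by rewrite /g; case: ifP => // _; exact: c0_ops0.
have ge (u : seq G) : uniq u -> \sum_(t <- u) nrm (g t) <= e.
  move=> uu; pose u' := [seq t <- u | t \notin bs].
  have -> : \sum_(t <- u) nrm (g t) = \sum_(t <- u') nrm (f t).
    rewrite big_filter [RHS]big_mkcond; apply: eq_bigr => t _; rewrite /g.
    by case: ifP => //= _; rewrite nrm0.
  have uBu : uniq (bs ++ u').
    rewrite cat_uniq ubs filter_uniq// andbT; apply/hasPn => t.
    by rewrite mem_filter => /andP[].
  have leA : \sum_(t <- bs ++ u') nrm (f t) <= sup A.
    by apply: ub_le_sup; [exact: supA.2|exists (bs ++ u')].
  have le0 : \sum_(t <- s0) nrm (f t) <= \sum_(t <- bs) nrm (f t).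
    by apply: ler_sum_sub => // t; exact: nrm_ge0.
  by move: leA; rewrite big_cat/=; move: le0 supe; lra.
apply: eq_mbound (crossed_kernel_mbound (ltW e0) cg ge) => p' q'.
apply: esym; rewrite (entB coP) Tf /summability.partial_sum.
rewrite -(finmap.big_seq_fsetE _ _ xpredT (fun t => covariant_term (f t) t)) /=.
rewrite (ent_sum coP) ent_sum_covariant//.
rewrite /crossed_kernel /g.
case: ifP => _; last by rewrite mul0r subr0.
by rewrite mul1r subrr [diagonal _ _](entryE 0) (ent0 coordinates_ell2) mulr0.
Qed.

End crossed_product_entries.

Lemma closure_nrmP {R : realType} {V : normedModType R[i]} (A : set V) x :
  closure A x <-> forall eps : R, 0 < eps -> exists2 y, A y & nrm (x - y) < eps.
Proof.
split=> [Ax e e0|Ax B /nbhs_ballP[[e e'] /=]].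
  have eC : (0 : R[i]) < e%:C by rewrite ltcR.
  have [y [Ay]] := Ax _ (nbhsx_ballx x _ eC).
  by rewrite -ball_normE /= (nrmE (x - y)) ltcR; exists y.
rewrite ltcE /= => /andP[/eqP -> e0] xB; have [y Ay xy] := Ax e e0.
by exists y; split=> //; apply: xB; rewrite -ball_normE /= (nrmE (x - y)) ltcR.
Qed.

(** * Linear structure of the image of l^1 and entries on the crossed product *)

Section integrated_forms.
Context {R : realType} {G : groupType}.
Local Notation C := R[i].
Local Notation H := (ell2 G C^o).
Local Notation HG := (ell2 G H).
Let coP : coordinates (crossed_co : HG -> G * G -> C) :=
  coordinates_nested coordinates_ell2 G.
Local Notation integ := (integrated (c0_action : G -> bop H H -> bop H H)).
Local Notation ell1 := (l1 (c0_ops : set (bop H H)) : set (G -> bop H H)).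
Local Notation AG := (crossed_product (c0_ops : set (bop H H))
  (c0_action : G -> bop H H -> bop H H)).

Lemma diagonalZD c (S T : bop H H) s :
  diagonal (c *: S + T) s = c * diagonal S s + diagonal T s.
Proof.
apply: (etrans (entryE _ s s)); apply: (etrans (entD coordinates_ell2 _ _ _ _)).
apply: (congr2 (fun u v => u + v)); last exact: (esym (entryE T s s)).
apply: (etrans (entZ coordinates_ell2 c S s s)).
exact: (congr1 (fun u => c * u) (esym (entryE S s s))).
Qed.

Lemma l1ZD c (f g : G -> bop H H) : ell1 f -> ell1 g -> ell1 (fun t => c *: f t + g t).
Proof.
move=> /l1P[cf [M fM]] /l1P[cg [N gN]]; apply/l1P; split=> [t|].
  by apply: c0_opsZD.
exists (ab c * M + N) => u uu.
apply: (@le_trans _ _ (\sum_(t <- u) (ab c * nrm (f t) + nrm (g t)))).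
  apply: ler_sum => t _; apply: le_trans (nrmD _ _) _.
  by rewrite lerD2r (nrmZ c (f t)).
rewrite big_split/= -mulr_sumr lerD ?gN//.
by apply: ler_wpM2l (fM u uu); exact: ab_ge0.
Qed.

Lemma integratedZD c (f g : G -> bop H H) : ell1 f -> ell1 g ->
  c *: integ f + integ g = integ (fun t => c *: f t + g t).
Proof.
move=> lf lg; apply: (ent_inj coP) => p q.
apply: (etrans (entZD coP c (integ f) (integ g) p q)).
apply: (etrans (congr2 (fun u v => c * u + v) (ent_integrated p q lf)
  (ent_integrated p q lg))).
apply: (etrans _ (esym (ent_integrated p q (l1ZD c lf lg)))).
by rewrite /crossed_kernel diagonalZD mulrDr mulrCA.
Qed.

Lemma integrated_sum J (s : seq J) (c : J -> C) (f : J -> G -> bop H H) :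
  (forall j, ell1 (f j)) ->
  (integ @` ell1) (\sum_(j <- s) c j *: integ (f j)).
Proof.
move=> lf; elim: s => [|j s [g lg E]].
  have l0 : ell1 (fun=> 0).
    apply/l1P; split=> [_|]; first exact: c0_ops0.
    by exists 0 => u _; rewrite big1// => t _; rewrite nrm0.
  exists (fun=> 0) => //; rewrite big_nil; apply: (ent_inj coP) => p q.
  apply: (etrans (ent_integrated p q l0)); apply: (etrans _ (esym (ent0 coP p q))).
  by rewrite /crossed_kernel [diagonal _ _](entryE 0) (ent0 coordinates_ell2) mulr0.
rewrite big_cons -E (integratedZD (c j) (lf j) lg).
by exists (fun t => c j *: f j t + g t); first exact: (l1ZD (c j) (lf j) lg).
Qed.

(* The entry at ((s, r), (s', r)) depends only on (s r, s' r). *)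
Lemma crossed_product_ent T p q : AG T ->
  ent crossed_co T p q = (p.2 == q.2)%:R *
    ent crossed_co T ((p.1 * p.2)%g, 1%g) ((q.1 * q.2)%g, 1%g).
Proof.
move=> /closure_nrmP AT; apply/eqP; rewrite -subr_eq0; apply/eqP/ab_eq0/eqP.
rewrite eq_le ab_ge0 andbT; apply/ler_addgt0Pr => e e0.
have e2 : 0 < e / 2 by rewrite divr_gt0.
have [_ [f lf <-] /ltW Tf] := AT _ e2.
have E : ent crossed_co (integ f) p q = (p.2 == q.2)%:R *
    ent crossed_co (integ f) ((p.1 * p.2)%g, 1%g) ((q.1 * q.2)%g, 1%g).
  apply: (etrans (ent_integrated p q lf)).
  apply: (etrans _ (congr1 (fun u => (p.2 == q.2)%:R * u) (esym (ent_integrated _ _ lf)))).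
  rewrite /crossed_kernel eqxx mul1r /=.
  case: eqP => [->|]; last by rewrite !mul0r.
  by rewrite mulg1 invgM mulgA mulgK.
have d x y : ab (ent crossed_co T x y - ent crossed_co (integ f) x y) <= e / 2.
  exact: le_trans (ab_entB coP _ _ _ _) Tf.
set x := ((p.1 * p.2)%g, 1%g); set y := ((q.1 * q.2)%g, 1%g).
have -> : ent crossed_co T p q - (p.2 == q.2)%:R * ent crossed_co T x y =
    (ent crossed_co T p q - ent crossed_co (integ f) p q) -
    (p.2 == q.2)%:R * (ent crossed_co T x y - ent crossed_co (integ f) x y).
  by rewrite E -/x -/y; ring.
rewrite add0r [e]splitr; apply: le_trans (abD _ _) _; apply: lerD; first exact: d.
rewrite abN abM; case: eqP => _; first by rewrite ab1 mul1r d.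
by rewrite ab0 mul0r ltW.
Qed.

(** Counterpart in l^1 of the matrix unit at (p, q): the matrix of its integrated form is that unit
    inflated along (s, r) |-> s r, restricted to equal second coordinates. *)
Definition crossed_unit (p q : G) (t : G) : bop H H :=
  if t == (p * q^-1)%g then mulop (fun s => (s == p)%:R) else 0.

Lemma c0_delta (p : G) : c0 (fun s => (s == p)%:R : C).
Proof.
move=> e e0; apply: sub_finite_set (finite_set1 p) => s /=.
by case: eqP => // _; rewrite normr0 lecR leNgt e0.
Qed.

Lemma l1_crossed_unit p q : ell1 (crossed_unit p q).
Proof.
apply/l1P; split=> [t|].
  rewrite /crossed_unit; case: ifP => _; last exact: c0_ops0.
  by exists (fun s => (s == p)%:R) => //; exact: c0_delta.
exists (nrm (mulop (fun s => (s == p)%:R : C))) => u uu.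
have [pu|pu] := boolP (p * q^-1 \in u)%g.
  rewrite (bigD1_seq _ pu)//= big1 ?addr0 => [|t /negbTE tpq].
    by rewrite /crossed_unit eqxx.
  by rewrite /crossed_unit tpq nrm0.
rewrite big_seq big1 ?nrm_ge0// => t tu; rewrite /crossed_unit.
by case: eqP => [tpq|_]; [rewrite -tpq tu in pu|rewrite nrm0].
Qed.

Lemma ent_crossed_unit g h p q :
  ent crossed_co (integ (crossed_unit g h)) p q =
  ((p.2 == q.2) && ((p.1 * p.2 == g) && (q.1 * q.2 == h)))%g%:R.
Proof.
apply: (etrans (ent_integrated p q (l1_crossed_unit g h))); rewrite /crossed_kernel.
case: (eqVneq p.2 q.2) => [pq|]; last by rewrite mul0r.
have E : diagonal (crossed_unit g h (p.1 * q.1^-1)%g) (p.1 * p.2)%g =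
    ((p.1 * q.1^-1 == g * h^-1) && (p.1 * p.2 == g))%g%:R.
  rewrite /crossed_unit; case: eqP => _.
    by rewrite diagonal_mulop//; exact: c0_delta.
  by rewrite [diagonal _ _](entryE 0) (ent0 coordinates_ell2).
rewrite mul1r E pq andbC; case: eqP => //= <-.
congr (_%:R); congr nat_of_bool; apply/eqP/eqP => [|<-]; last first.
  by rewrite invgM mulgA mulgK.
rewrite -mulgA => /mulgI /(congr1 (fun x => x^-1)%g).
by rewrite invgM !invgK => ->; rewrite mulgVK.
Qed.

End integrated_forms.

(** * Maps given entrywise by an inflated Schur multiplier *)

Section schur_maps.
Context {R : realType}.
Local Notation C := R[i].

Lemma dist_le {E : normedModType C} (x a : E) (A : set E) : A a -> dist x A <= nrm (x - a).
Proof.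
move=> Aa; apply: ge_inf; first by exists 0 => _ [b _ <-]; exact: nrm_ge0.
by exists a.
Qed.

Lemma closure_linear {V : normedModType C} (A : set V) :
  (forall (a : C) x y, A x -> A y -> A (a *: x + y)) ->
  forall (a : C) x y, closure A x -> closure A y -> closure A (a *: x + y).
Proof.
move=> Al a x y /closure_nrmP Ax /closure_nrmP Ay; apply/closure_nrmP => e e0.
have a1 : 0 < ab a + 1 by rewrite ltr_wpDl ?ab_ge0.
have e2 : 0 < e / 2 by rewrite divr_gt0.
have [x' Ax' xx'] := Ax _ (divr_gt0 e2 a1); have [y' Ay' yy'] := Ay _ e2.
exists (a *: x' + y'); first exact: Al.
rewrite opprD addrACA -scalerBr [e]splitr; apply: le_lt_trans (nrmD _ _) _.
apply: ler_ltD => //; rewrite nrmZ -abE.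
apply: le_trans (ler_wpM2l (ab_ge0 a) (ltW xx')) _.
rewrite mulrCA ger_pMr// ler_pdivrMr// mul1r lerDl.
by rewrite ler01.
Qed.

Context {V : normedModType C} {I G : choiceType} {co : V -> I -> C}.
Hypothesis coP : coordinates co.
Variables (sigma tau : I -> G) (chi : G -> G -> C) (M : R).
Hypothesis chiM : schurb chi M.
Variables (X : set (bop V V)) (S : bop V V -> bop V V).
Hypothesis Xlin : forall (a : C) x y, X x -> X y -> X (a *: x + y).
Hypothesis SE : forall T, X T -> forall p q,
  ent co (S T) p q = chi (sigma p) (tau q) * ent co T p q.

Lemma schur_nrm_le (T T' : bop V V) :
  (forall p q, ent co T' p q = chi (sigma p) (tau q) * ent co T p q) ->
  nrm T' <= M * nrm T.
Proof.
move=> TT'; apply: (nrm_le_mbound coP).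
apply: eq_mbound (schurb_inflate sigma tau chiM (mbound_ent coP (lexx (nrm T)))).
by move=> p q; rewrite TT'.
Qed.

Lemma schur_linear_on : linear_on X S.
Proof.
move=> a x y Xx Xy; apply: (ent_inj coP) => p q.
rewrite (SE (Xlin a Xx Xy)) !(entZD coP) (SE Xx) (SE Xy); ring.
Qed.

Lemma schur_cb_bound : cb_bound X S M.
Proof.
move=> m x Xx; rewrite normr_nrm_le.
apply: (amp_schur_le (sigma := sigma) (tau := tau) coP chiM) => i j p q.
by rewrite mxE SE.
Qed.

Lemma schur_completely_bounded (Z : set (bop V V)) :
  (forall T, X T -> Z (S T)) -> completely_bounded X Z S.
Proof.
by move=> SZ; split=> //; [exact: schur_linear_on|exists M; exact: schur_cb_bound].
Qed.

Lemma schur_lipschitz x y : X x -> X y -> nrm (S x - S y) <= M * nrm (x - y).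
Proof.
by move=> Xx Xy; apply: schur_nrm_le => p q; rewrite !(entB coP) SE// SE// mulrBr.
Qed.

(** [W] supplies the approximant in [Y]. As S - W is entrywise multiplication by an inflation of
    [chi'], amplifying it keeps the bound [e], which makes the estimate uniform in [m]. *)
Lemma schur_dist_le (chi' : G -> G -> C) (e : R) (Y : set (bop V V))
    (W : bop V V -> bop V V) m (x : 'M[bop V V]_m) : schurb chi' e ->
  (forall T, X T -> Y (W T) /\ forall p q,
    ent co (S T - W T) p q = chi' (sigma p) (tau q) * ent co T p q) ->
  mx_over X x -> `|amp x| <= 1 ->
  dist (amp (map_mx S x)) (amp @` mx_over Y) <= e.
Proof.
move=> chi'e WT Xx x1; have [e0 _] := chi'e.
have YW : (amp @` mx_over Y) (amp (map_mx W x)).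
  by exists (map_mx W x) => // i j; rewrite mxE; have [] := WT _ (Xx i j).
apply: le_trans (dist_le _ YW) _; rewrite (ampB coP).
apply: (@le_trans _ _ (e * nrm (amp x))).
  apply: (amp_schur_le (sigma := sigma) (tau := tau) coP chi'e) => i j p q.
  by rewrite !mxE; have [_ ->] := WT _ (Xx i j).
by rewrite ler_piMr// -lecR -nrmE.
Qed.

End schur_maps.

Lemma closure_lipschitz {R : realType} {V W : normedModType R[i]} (A : set V)
    (B : set W) (S : V -> W) (M : R) : 0 <= M ->
  (forall x y, nrm (S x - S y) <= M * nrm (x - y)) ->
  (forall x, A x -> B (S x)) -> forall x, closure A x -> closure B (S x).
Proof.
move=> M0 SM AB x /closure_nrmP Ax; apply/closure_nrmP => e e0.
have M1 : 0 < M + 1 by rewrite ltr_wpDl.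
have [y Ay xy] := Ax _ (divr_gt0 e0 M1); exists (S y); first exact: AB.
apply: le_lt_trans (SM _ _) _; apply: le_lt_trans (ler_wpM2l M0 (ltW xy)) _.
by rewrite mulrCA gtr_pMr// ltr_pdivrMr// mul1r ltrDl.
Qed.

(** * The Herz-Schur multiplier and its finite-rank approximants *)

Section herz_schur.
Context {R : realType} {G : groupType}.
Local Notation C := R[i].
Local Notation H := (ell2 G C^o).
Local Notation HG := (ell2 G H).
Let coP : coordinates (crossed_co : HG -> G * G -> C) :=
  coordinates_nested coordinates_ell2 G.
Local Notation act := (c0_action : G -> bop H H -> bop H H).
Local Notation D := (c0_ops : set (bop H H)).
Local Notation integ := (integrated act).
Local Notation AG := (crossed_product D act).

Variables (phi : G -> G -> C) (M : R).
Hypothesis phiM : schurb (fun p q => phi p q) M.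

Definition herz_map (s : G) : bop H H -> bop H H :=
  mulop_lift (fun a t => phi t (s^-1 * t)%g * a t).

Lemma c0_herz_map s (T : bop H H) : D T ->
  c0 (fun t => phi t (s^-1 * t)%g * diagonal T t).
Proof. by move=> /c0_diagonal; apply: c0_mul => t; exact: (schurb_le _ _ phiM). Qed.

Lemma c0_ops_herz_map s (T : bop H H) : D T -> D (herz_map s T).
Proof. by move=> /(c0_herz_map s) cT; eexists; first exact: cT. Qed.

Lemma diagonal_herz_map s (T : bop H H) t : D T ->
  diagonal (herz_map s T) t = phi t (s^-1 * t)%g * diagonal T t.
Proof. by move=> /(c0_herz_map s) cT; have /(congr1 (fun a => a t)) := diagonal_mulop cT. Qed.

(** Both matrices are diagonal, and at p = q the weight is psi(s, p). Writing it with separate p and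
    q, and with [id], exhibits [herz_map s] as an inflation of [phi], which gives the bound [M] for
    all s at once. *)
Lemma ent_herz_map s (T : bop H H) p q : D T ->
  ent ell2_co (herz_map s T) p q = phi (id p) (s^-1 * q)%g * ent ell2_co T p q.
Proof.
move=> DT; rewrite -!entryE (entry_c0_ops p q DT).
rewrite (entry_c0_ops p q (c0_ops_herz_map s DT)) diagonal_herz_map//.
by case: eqP => [->|]; rewrite ?mul0r ?mulr0// !mul1r.
Qed.

Lemma nrm_herz_map s (T : bop H H) : D T -> nrm (herz_map s T) <= M * nrm T.
Proof.
move=> DT; apply: (schur_nrm_le (sigma := id) (tau := fun q => (s^-1 * q)%g)
  coordinates_ell2 phiM) => p q.
exact: ent_herz_map.
Qed.

Lemma l1_herz_map (f : G -> bop H H) : l1 D f -> l1 D (fun t => herz_map t (f t)).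
Proof.
move=> /l1P[cf [N fN]]; apply/l1P; split=> [t|]; first exact: c0_ops_herz_map.
exists (M * N) => u uu; apply: (@le_trans _ _ (\sum_(t <- u) M * nrm (f t))).
  by apply: ler_sum => t _; exact: nrm_herz_map.
by rewrite -mulr_sumr ler_wpM2l ?fN//; case: phiM.
Qed.

Definition total_mul (p : G * G) : G := (p.1 * p.2)%g.

(** The map is obtained on all bounded operators of l^2(G x G), so the same [S] acts on the image of
    l^1 and on its closure; in place of an extension by density, only invariance of these sets
    remains to be checked. *)
Lemma crossed_schur_exists : exists S : bop HG HG -> bop HG HG, forall T p q,
  ent crossed_co (S T) p q = phi (total_mul p) (total_mul q) * ent crossed_co T p q.
Proof.
have ex (T : bop HG HG) : exists S : bop HG HG, forall p q,
    ent crossed_co S p q = phi (total_mul p) (total_mul q) * ent crossed_co T p q.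
  by have [S SE _] := schur_exists coP total_mul total_mul T phiM; exists S.
by have [S SE] := choice ex; exists S.
Qed.

Variable S : bop HG HG -> bop HG HG.
Hypothesis SE : forall T p q,
  ent crossed_co (S T) p q = phi (total_mul p) (total_mul q) * ent crossed_co T p q.

(** At ((s, r), (s', r)) the group element is t = s s'^-1, and t^-1 (s r) = s' r; hence psi(t, s r)
    = phi(s r, s' r). *)
Lemma crossed_schur_rel : herz_schur_rel D act herz_map S.
Proof.
move=> f lf; apply: (ent_inj coP) => p q; apply: (etrans (SE _ p q)).
apply: (etrans (congr1 (fun u => phi (total_mul p) (total_mul q) * u) (ent_integrated p q lf))).
apply: (etrans _ (esym (ent_integrated p q (l1_herz_map lf)))).
case: lf => cf _; rewrite /crossed_kernel diagonal_herz_map// /total_mul.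
case: eqP => [pq|]; last by rewrite !mul0r mulr0.
by rewrite !mul1r invgM invgK mulgA mulgVK pq.
Qed.

Lemma crossed_schur_integrated T : (integ @` l1 D) T -> (integ @` l1 D) (S T).
Proof.
move=> [f lf <-]; exists (fun t => herz_map t (f t)); first exact: l1_herz_map.
exact: (esym (crossed_schur_rel lf)).
Qed.

Lemma integrated_linear (a : C) x y : (integ @` l1 D) x -> (integ @` l1 D) y ->
  (integ @` l1 D) (a *: x + y).
Proof.
move=> [f lf <-] [g lg <-]; rewrite (integratedZD a lf lg).
by exists (fun t => a *: f t + g t); first exact: (l1ZD a lf lg).
Qed.

Lemma herz_schur_multiplier_herz_map : herz_schur_multiplier D act herz_map.
Proof.
have E s T : D T -> forall p q, ent ell2_co (herz_map s T) p q =
    phi (id p) (s^-1 * q)%g * ent ell2_co T p q by move=> DT p q; exact: ent_herz_map.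
split.
- move=> s; apply: (schur_completely_bounded (sigma := id)
    (tau := fun q => (s^-1 * q)%g) coordinates_ell2 phiM _ (E s)).
    by move=> a x y; exact: c0_opsZD.
  exact: c0_ops_herz_map.
- exists M => s; exact: (schur_cb_bound (sigma := id)
    (tau := fun q => (s^-1 * q)%g) coordinates_ell2 phiM (E s)).
- exists S; split; first exact: crossed_schur_rel.
  apply: (schur_completely_bounded (sigma := total_mul) (tau := total_mul)
    coP phiM integrated_linear (fun T _ => SE T)).
  exact: crossed_schur_integrated.
Qed.

(** Invariance of the crossed product under [S] follows from invariance of the image of l^1, because
    [S] is Lipschitz with constant [M]. *)
Lemma crossed_completely_bounded : completely_bounded AG AG S.
Proof.
apply: (schur_completely_bounded (sigma := total_mul) (tau := total_mul)
  coP phiM (closure_linear integrated_linear) (fun T _ => SE T)).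
have M0 : 0 <= M by case: phiM.
have L x y : nrm (S x - S y) <= M * nrm (x - y).
  exact: (schur_lipschitz (X := setT) (sigma := total_mul) (tau := total_mul)
    coP phiM (fun T _ => SE T) I I).
exact: (closure_lipschitz M0 L crossed_schur_integrated).
Qed.

Section truncation.
Variables (s : seq G).
Hypothesis us : uniq s.
(* The range of the truncated multiplier is spanned by the elements
   pi(M_(delta_p)) lambda_(p q^-1) for p, q in s. *)
Let pairs := [seq (p, q) | p <- s, q <- s].

Definition truncated_span : set (bop HG HG) :=
  [set \sum_(k < size pairs) c k *:
     integ (crossed_unit (tnth (in_tuple pairs) k).1 (tnth (in_tuple pairs) k).2)
   | c in [set: 'I_(size pairs) -> C]].

Lemma finite_dim_truncated_span : finite_dim truncated_span.
Proof. by exists (size pairs); eexists; reflexivity. Qed.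

Lemma truncated_span_sub : truncated_span `<=` AG.
Proof.
move=> _ [c _ <-]; apply: subset_closure.
apply: (@integrated_sum _ _ _ _ c (fun k => crossed_unit (tnth (in_tuple pairs) k).1
  (tnth (in_tuple pairs) k).2)) => k.
exact: l1_crossed_unit.
Qed.

(** The coefficient at a pair (p, q) is the entry of S T at ((p, 1), (q, 1)), the representative of
    all positions with products p and q. *)
Definition truncated (T : bop HG HG) : bop HG HG :=
  \sum_(k < size pairs) (let pq := tnth (in_tuple pairs) k in
    phi pq.1 pq.2 * ent crossed_co T (pq.1, 1%g) (pq.2, 1%g)) *:
     integ (crossed_unit (tnth (in_tuple pairs) k).1 (tnth (in_tuple pairs) k).2).

(** At given positions at most one pair of the sum survives, the pair of products; membership in the
    crossed product then carries the entry read at second coordinate 1 back to the actual position.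
    The order of the two tests is that of the transposed truncation. *)
Lemma ent_truncated (T : bop HG HG) p q : AG T ->
  ent crossed_co (truncated T) p q =
  ((total_mul q \in s) && (total_mul p \in s))%:R *
    (phi (total_mul p) (total_mul q) * ent crossed_co T p q).
Proof.
move=> AT; apply: (etrans (ent_sumZ coP _ _ _ _ _)) => /=.
pose F (pq : G * G) := phi pq.1 pq.2 * ent crossed_co T (pq.1, 1%g) (pq.2, 1%g) *
  ((p.2 == q.2) && ((p.1 * p.2 == pq.1) && (q.1 * q.2 == pq.2)))%g%:R.
transitivity (\sum_(k < size pairs) F (tnth (in_tuple pairs) k)).
  apply: eq_bigr => k _; rewrite /F; congr (_ * _); exact: ent_crossed_unit.
rewrite -(big_tuple _ _ (in_tuple pairs) xpredT F) /= big_allpairs.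
rewrite (crossed_product_ent p q AT) -/(total_mul p) -/(total_mul q) /F /=.
case: (p.2 == q.2) => /=; last first.
  by rewrite mul0r !mulr0 big1// => g _; rewrite big1// => h _; rewrite mulr0.
rewrite mul1r; set e := fun g h => phi g h * ent crossed_co T (g, 1%g) (h, 1%g).
transitivity (\sum_(g <- s | g == total_mul p) \sum_(h <- s | h == total_mul q) e g h).
  rewrite [RHS]big_mkcond; apply: eq_bigr => g _.
  rewrite -[in RHS](eq_sym (total_mul p)); case: (total_mul p == g) => /=; last first.
    by rewrite big1// => h _; rewrite mulr0.
  rewrite [RHS]big_mkcond; apply: eq_bigr => h _.
  by rewrite eq_sym /total_mul; case: eqP => _; rewrite ?mulr1 ?mulr0.
have [ps|ps] := boolP (total_mul p \in s); last first.
  rewrite andbF mul0r big_seq_cond big1// => g /andP[gs /eqP gp].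
  by rewrite -gp gs in ps.
rewrite big_seq_pred1//; have [qs|qs] := boolP (total_mul q \in s); last first.
  rewrite mul0r big_seq_cond big1// => g /andP[gs /eqP gp].
  by rewrite -gp gs in qs.
by rewrite big_seq_pred1// mul1r.
Qed.

Lemma truncated_spanP (T : bop HG HG) : truncated_span (truncated T).
Proof. by eexists. Qed.

End truncation.
End herz_schur.

Theorem corollary5p4 (R : realType) (G : groupType) (phi : G -> G -> R[i]) :
  compact_schur_multiplier phi ->
  let psi := fun s t : G => phi t (s^-1 * t)%g in
  let h := fun s t : G => psi s t in
  let F := fun s : G => mulop_lift (fun a t => h s t * a t) in
  completely_compact_herz_schur_multiplier c0_ops c0_action F.
Proof.
move=> cphi psi h F; have [M /schurb_tr phiM] := schur_multiplier_schurb cphi.1.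
have [S SE] := crossed_schur_exists phiM.
split; first exact: (herz_schur_multiplier_herz_map phiM SE).
have cbS := crossed_completely_bounded phiM SE.
exists S; split; first by split; [exact: (crossed_schur_rel phiM SE)|].
split=> // eps e0; have e2 : 0 < eps / 2 by rewrite divr_gt0.
have [s us /schurb_tr se] := compact_schur_truncation cphi e2.
exists (truncated_span s); split.
- exact: truncated_span_sub.
- exact: finite_dim_truncated_span.
(* The distance estimate is not strict, so the truncation was made at eps / 2. *)
move=> m x AGx x1; apply: (@le_lt_trans _ _ (eps / 2)); last first.
  by rewrite ltr_pdivrMr// ltr_pMr// ltr1n.
apply: (schur_dist_le (sigma := total_mul) (tau := total_mul)
  (coordinates_nested coordinates_ell2 G) (W := truncated phi s) se _ AGx x1).
move=> T AT; split=> [|p q]; first exact: truncated_spanP.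
apply: (etrans (entB (coordinates_nested coordinates_ell2 G) _ _ _ _)).
apply: (etrans (congr2 (fun u v => u - v) (SE T p q) (ent_truncated phi us p q AT))).
by rewrite /= mulrBl mul1r mulrBl mulrA.
Qed.
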